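(* Assume that there are constants $\chi,\sigma>0$ such that for every $f\in F$, $$(P f^4)^{1/4}\leq \chi (Pf^2)^{1/2}\quad\text{and}\quad P\left[(Y-f^* )^2(f-f^* )^2\right]\leq \sigma^2 P(f-f^* )^2 .$$ Let $\rho:\Lambda\times\mathbb{N}^*\to\mathbb{R}_+\cup\{+\infty\}$ be a function that is non-increasing in its second variable, let $\nu:\Lambda\to\mathbb{R}_+^*=(0,\infty)$, and let $\nu_{\max}:=\lceil\max_{\lambda\in\Lambda}\nu(\lambda)\rceil$. Assume that $N\geq\nu_{\max}\max(8V,2^{K_{\min}+1})$ and that $3|\mathcal{O}|\leq V\leq 2^{K_{\max}-1}$. Assume that, for all $\lambda\in\Lambda$ and all $B\subset\mathcal{I}$ such that $|B|\geq\nu(\lambda)$, one has $\ell(\hat f_{\lambda,B})\leq\rho(\lambda,|B|)$ with probability larger than $1-\exp(-1/48)$. Then, for all $\varepsilon>0$, the estimator $\hat f_{\hat m}$ selected by the ensemble method satisfies $$(1-a_{\varepsilon,V})\,\ell(\hat f_{\hat m})\leq(1+3a_{\varepsilon,V})\min_{\lambda\in\Lambda}\rho\left(\lambda,\left\lfloor\frac{N}{\max(4V,2^{K_{\min}})}\right\rfloor\right)+2b_{\varepsilon,V}$$ with probability larger than $1-(|\Lambda|^2N^2+1)e^{-V/48}$, where $a_{\varepsilon,V}:=8\chi^2\sqrt{2V/N}+2\sqrt2\,\varepsilon$ and $b_{\varepsilon,V}:=\dfrac{64V\sigma^2}{N\varepsilon}$.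
   Context: Notation: $[k]=\{1,\dots,k\}$. Let $\mathbb{X}$ be a measurable space, $P$ a probability distribution on $\mathbb{X}\times\mathbb{R}$, $(X,Y)\sim P$ with $\mathbb{E}[Y^2]<+\infty$, and $P_X$ the marginal distribution of $X$. $L^2(P_X)$ is the Hilbert space of measurable $f:\mathbb{X}\to\mathbb{R}$ with $\mathbb{E}[f(X)^2]<\infty$, with norm $\|f\|=\sqrt{\mathbb{E}[f(X)^2]}$. For a probability measure $Q$ and $g\in L^1(Q)$, $Q[g]=\mathbb{E}_{Z\sim Q}[g(Z)]$ (so, e.g., $Pf^2=\mathbb{E}[f(X)^2]$ and $P[(Y-f^* )^2(f-f^* )^2]=\mathbb{E}[(Y-f^*(X))^2(f(X)-f^*(X))^2]$). Let $F$ be a linear subspace of $L^2(P_X)$. For $f\in F$, $\gamma(f)(x,y)=(y-f(x))^2$, $R(f)=P[\gamma(f)]$, $f^*=\operatorname{argmin}_{f\in F}R(f)$ (the oracle, taken to exist), and the excess risk is $\ell(f)=R(f)-R(f^* )=\|f-f^*\|^2$. A learning algorithm is a measurable map $G:\bigcup_{n\ge1}(\mathbb{X}\times\mathbb{R})^n\to F$. Data: a dataset $(X_i,Y_i)_{i\in[N]}$, with $[N]=\mathcal{O}\sqcup\mathcal{I}$. The informative data $(X_i,Y_i)_{i\in\mathcal{I}}$ are i.i.d. with distribution $P$; no assumption is made on the outliers $(X_i,Y_i)_{i\in\mathcal{O}}$. For nonempty $B\subset[N]$ (a subsample), $P_B[g]=\frac1{|B|}\sum_{i\in B}g(X_i,Y_i)$.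 Ensemble method: $(G_\lambda)_{\lambda\in\Lambda}$ is a finite collection of learning algorithms, and $\hat f_{\lambda,B}=G_\lambda((X_i,Y_i)_{i\in B})$. Assume $N\geq8$ and let $K_{\min},K_{\max}$ be integers with $3\leq K_{\min}\leq K_{\max}\leq\log_2N$. For each integer $K$ with $K_{\min}\leq K\leq K_{\max}$, let $(B_k^{(K)})_{k\in[2^K]}$ be a partition of $[N]$ with $\lfloor N/2^K\rfloor\leq|B_k^{(K)}|$ for all $k\in[2^K]$, each block having cardinality less than $N/4$. Let $$\mathcal{B}=\bigcup_{K=K_{\min}}^{K_{\max}}\bigcup_{k\in[2^K]}\{B_k^{(K)}\},\qquad \mathcal{M}=\Lambda\times\mathcal{B}.$$ For $m=(\lambda,B)\in\mathcal{M}$ put $B_m=B$ and $\hat f_m=\hat f_{\lambda,B}$. $V$ is an integer with $3\leq V\leq N/8$. For each $(m,m')\in\mathcal{M}^2$, $(T_v^{(m,m')})_{v\in[V]}$ is a partition of a subset of $[N]\setminus(B_m\cup B_{m'})$ with $|T_v^{(m,m')}|\geq N/(4V)$ for all $v$. Define $$\mathcal{T}(m,m')=\operatorname{med}_{v\in[V]}\left\{P_{T_v^{(m,m')}}[\gamma(\hat f_m)-\gamma(\hat f_{m'})]\right\}\ (\text{median}),\qquad \hat m\in\operatorname{argmin}_{m\in\mathcal{M}}\max_{m'\in\mathcal{M}}\mathcal{T}(m,m').$$ The output of the method is $\hat f_{\hat m}$.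
   Formalization: The outliers, otherwise arbitrary (any joint law, deterministic values included), are assumed independent of the informative data; if an outlier may encode the informative data, a contaminated block can yield an overfitted predictor that is selected, and the claim fails. *)

(* Defs.v *)
From HB Require Import structures.
From mathcomp Require Import all_boot all_order all_algebra.
From mathcomp Require Import all_classical all_reals all_analysis.
Set Implicit Arguments.
Unset Strict Implicit.
Unset Printing Implicit Defensive.
Import Order.TTheory GRing.Theory Num.Theory.
Import numFieldNormedType.Exports.
Local Open Scope classical_set_scope.
Local Open Scope ring_scope.

Definition mfun_fst d d' (T : measurableType d) (T' : measurableType d') :
  {mfun (T * T')%type >-> T} := mfun_Sub (mem_set (@measurable_fst d d' T T')).

Definition marginalX d (X : measurableType d) (R : realType)
    (P : probability (X * R)%type R) : probability X R :=
  distribution P (mfun_fst X R).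

(* When [E] is measurable this says [p%:E <= Pr E]; otherwise it bounds the
   inner measure, so that no measurability is needed of a selector (or of a
   choice of medians) occurring in [E]. *)
Definition probability_at_least d (Omega : measurableType d) (R : realType)
    (Pr : probability Omega R) (p : R) (E : set Omega) : Prop :=
  exists A : set Omega, [/\ measurable A, A `<=` E & (p%:E <= Pr A)%E].

Section independence.
Context d d' (Omega : measurableType d) (T : measurableType d') (R : realType).
Variables (Pr : probability Omega R) (I : finType) (Z : I -> {RV Pr >-> T}).

Definition generated_by (J : {set I}) : set (set Omega) :=
  <<s \bigcup_(i in [set` J]) preimage_set_system setT (Z i) measurable >>.

(* Used for outliers versus informative data. The joint law within the family
   of outliers stays arbitrary (deterministic outliers included), but an outlier
   may not encode informative data: a training block containing it would
   otherwise carry information about the test folds. *)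
Definition independent_subfamilies (J J' : {set I}) : Prop :=
  forall A A' : set Omega, generated_by J A -> generated_by J' A' ->
    (Pr (A `&` A') = Pr A * Pr A')%E.

Definition mutually_independent (J : {set I}) : Prop :=
  forall (S : {set I}) (A : I -> set T), S \subset J ->
    (forall i, i \in S -> measurable (A i)) ->
    (Pr (\bigcap_(i in [set` S]) (Z i @^-1` A i)) =
     \prod_(i in S) Pr (Z i @^-1` A i))%E.

Definition iid_on (J : {set I}) (P : probability T R) : Prop :=
  mutually_independent J /\
  forall i, i \in J -> forall A, measurable A -> distribution Pr (Z i) A = P A.

End independence.

(* For an even number of values this allows every point between the two middle
   ones. *)
Definition is_median (R : realType) (V : nat) (x : 'I_V -> R) (t : R) : Prop :=
  (V <= 2 * #|[pred i | x i <= t]%R|)%N /\ (V <= 2 * #|[pred i | t <= x i]%R|)%N.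

Definition is_partition_of (T I : finType) (B : I -> {set T}) (D : {set T}) :
    Prop :=
  (forall i j, i != j -> [disjoint B i & B j]%bool) /\ (\bigcup_i B i)%SET = D.

Section regression.
Context d (X : measurableType d) (R : realType).
Implicit Types (P : probability (X * R)%type R) (f g : X -> R).

Definition gamma f : X * R -> R := fun z => (z.2 - f z.1) ^+ 2.

Definition risk P f : \bar R := 'E_P[gamma f]%E.

Definition is_oracle P (F : {pred X -> R}) (fstar : X -> R) : Prop :=
  fstar \in F /\ forall f, f \in F -> (risk P fstar <= risk P f)%E.

Definition excess_risk P (fstar f : X -> R) : \bar R :=
  (risk P f - risk P fstar)%E.

(* The values of an algorithm are functions, not classes modulo [P_X]-null
   sets, because they are evaluated at the data points. Measurability is joint
   in the dataset and the evaluation point. *)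
Definition learning_algorithm (F : {pred X -> R})
    (G : forall n, n.-tuple (X * R)%type -> X -> R) : Prop :=
  forall n, (0 < n)%N ->
    (forall s, G n s \in F) /\
    measurable_fun [set: (n.-tuple (X * R)%type * X)%type]
      (fun p : n.-tuple (X * R)%type * X => G n p.1 p.2).

Section sample.
Context (N : nat).
Implicit Types (z : 'I_N -> X * R) (B : {set 'I_N}).

Definition empirical z B (g : X * R -> R) : R :=
  #|B|%:R^-1 * \sum_(i in B) g (z i).

Definition subsample z B : #|B|.-tuple (X * R)%type :=
  map_tuple z (enum_tuple (mem B)).

Definition estimator (Lambda : Type)
    (G : Lambda -> forall n, n.-tuple (X * R)%type -> X -> R) z
    (m : Lambda * {set 'I_N}) : X -> R :=
  G m.1 #|m.2| (subsample z m.2).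

End sample.
End regression.

Definition all_blocks (N Kmin Kmax : nat)
    (Bl : forall K : nat, 'I_(2 ^ K) -> {set 'I_N}) : {set {set 'I_N}} :=
  (\bigcup_(Kmin <= K < Kmax.+1) \bigcup_(k < 2 ^ K) [set Bl K k])%SET.

Definition candidates (Lambda : finType) (N : nat) (BB : {set {set 'I_N}}) :
  {set Lambda * {set 'I_N}} := finset.setX [set: Lambda]%SET BB.

Definition is_minimax (R : realType) (M : finType) (C : {set M})
    (T : M -> M -> R) (mhat : M) : Prop :=
  mhat \in C /\ forall m, m \in C ->
    (\big[maxe/-oo]_(m' in C) (T mhat m')%:E <=
     \big[maxe/-oo]_(m' in C) (T m m')%:E)%E.

Definition a_const (R : realType) (chi eps : R) (N V : nat) : R :=
  8 * chi ^+ 2 * Num.sqrt (2 * V%:R / N%:R) + 2 * Num.sqrt 2 * eps.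

Definition b_const (R : realType) (sigma eps : R) (N V : nat) : R :=
  64 * V%:R * sigma ^+ 2 / (N%:R * eps).

(* Main.v *)
Require Import Defs.
From HB Require Import structures.
From mathcomp Require Import all_boot all_order all_algebra.
From mathcomp Require Import all_classical all_reals all_analysis.
From mathcomp Require Import measurable_realfun.
From mathcomp Require Import ring lra zify.
Import Order.TTheory GRing.Theory Num.Theory.
Import numFieldNormedType.Exports.
Local Open Scope classical_set_scope.
Local Open Scope ring_scope.

(** Write l(f) for the excess risk of f. The proof reduces the theorem to a
deterministic fact about a finite tournament, and then bounds the probability
that the data violate its hypotheses.

Deterministic part. Suppose that every test satisfies
|T(m, m') - (l(m) - l(m'))| <= a (l(m) + l(m')) + b. Against the best
candidate mo, the minimax winner mhat loses at most what mo loses against the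
whole field, which is at most 2 a l(mo) + b; on the other hand T(mhat, mo) is
at least (1 - a) l(mhat) - (1 + a) l(mo) - b. Combining the two gives
(1 - a) l(mhat) <= (1 + 3 a) l(mo) + 2 b [minimax_selection]. It remains to
find a candidate whose excess risk is below the target rate, and to show that
all tests are accurate.

A good candidate. At a resolution K with 2 V <= 2 ^ K <= max(4 V, 2 ^ Kmin),
at least V blocks contain no outlier. Their training successes are independent
events of probability at least 1 - exp(-1/48), so all of them fail with
probability at most exp(-V/48) [some_block_well_trained].

Accurate tests. Since the oracle minimizes the risk over a linear space, its
residual is orthogonal to the model, so l(f) is a squared distance
[excess_riskE]. The two moment assumptions then bound the second moment of the
difference of the losses of two predictors [loss_diff_moments]. Given the
training data, Chebyshev's inequality shows that the mean over a fold without
outliers errs by more than a L + b with probability at most 1/12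
[fold_deviation_rare]. As the folds are independent of the training data and
of each other, j given folds err simultaneously with probability at most
12 ^ (-j) [clean_folds_deviate], and a Chernoff bound makes V/6 such errors
very unlikely [many_occurring_rare]. At most V/3 folds contain outliers, so
apart from that rare event fewer than half of the folds are wrong and the
median is as accurate as a single good fold [median_robust].

Training blocks may contain outliers, and outliers may depend on each other.
What conditioning on the training data requires is only that the data with
index in J be independent of the data with index in K as soon as J and K are
disjoint and K contains no outlier [disjoint_independent]. Conditioning itself
is Fubini's theorem for the product of the two image measures [freezing].

The tests are accurate up to probability exp(-V/36) for each pair. There can be
almost 2 N blocks, hence 4 |Lambda|^2 N^2 pairs, and the factor 4 is absorbed
when passing from exp(-V/36) to exp(-V/48). This requires V to be large, but for
V < 288 the announced confidence level is nonpositive and there is nothing to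
prove. *)

Set Implicit Arguments.
Unset Strict Implicit.
Unset Printing Implicit Defensive.

(** * Independence of the sigma-algebras of disjoint subfamilies *)

Section independent_sigma_algebras.
Context d (Omega : measurableType d) (R : realType).
Variable (Pr : probability Omega R).
Implicit Types (C D : set (set Omega)) (a b : set Omega).
Local Open Scope ereal_scope.

Definition independent_classes C D :=
  forall a b, C a -> D b -> Pr (a `&` b) = Pr a * Pr b.

(** The events satisfying the product rule with b form a Dynkin system, so it
suffices to check the rule on a pi-system of generators. *)
Lemma independent_event_generated C b : C `<=` measurable -> setI_closed C ->
    measurable b -> (forall a, C a -> Pr (a `&` b) = Pr a * Pr b) ->
  forall a, <<s C >> a -> Pr (a `&` b) = Pr a * Pr b.
Proof.
move=> mC CI mb Cb a.
rewrite -(setI_closed_g_dynkin_g_sigma_algebra CI) => Ca.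
suff /(_ a Ca)[] : <<d C >> `<=`
    [set a | measurable a /\ Pr (a `&` b) = Pr a * Pr b] by [].
apply: smallest_sub => [|c Cc]; last by split; [exact: mC|exact: Cb].
split => [|c [mc cb]|F tF Fb].
- by split=> //; rewrite setTI probability_setT mul1e.
- split; first exact: measurableC.
  have -> : Pr (~` c `&` b) = Pr b - Pr (b `&` c).
    by rewrite setIC -setDE measureD// ltey_eq fin_num_measure.
  have -> : Pr (b `&` c) = Pr b * Pr c by rewrite setIC cb muleC.
  rewrite probability_setC// [RHS]muleC muleBr ?mule1 ?fin_num_measure//.
- have mF n : measurable (F n) by have [] := Fb n.
  split; first exact: bigcupT_measurable.
  rewrite setI_bigcupl measure_bigcup//=; last 2 first.
  + by move=> n _; exact: measurableI.
  + by apply: trivIset_setIr.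
  rewrite measure_bigcup//= muleC.
  rewrite -[Pr b]fineK ?fin_num_measure// -nneseriesZl//.
  apply: eq_eseriesr => n _; have [_ ->] := Fb n.
  by rewrite fineK ?fin_num_measure// muleC.
Qed.

Lemma independent_classes_generated C D :
    C `<=` measurable -> D `<=` measurable -> setI_closed C -> setI_closed D ->
  independent_classes C D -> independent_classes <<s C >> <<s D >>.
Proof.
move=> mC mD CI DI CD a b Ca Db.
have mCs : <<s C >> `<=` measurable.
  by apply: smallest_sub => //; exact: sigma_algebra_measurable.
rewrite setIC muleC; apply: (independent_event_generated mD) Db => //.
  exact: mCs.
move=> {}b Db; rewrite setIC muleC.
apply: (independent_event_generated mC) Ca => //; first exact: mD.
by move=> c Cc; exact: CD.
Qed.

End independent_sigma_algebras.

Section disjoint_subfamilies.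
Context d d' (Omega : measurableType d) (T : measurableType d') (R : realType).
Variables (Pr : probability Omega R) (I : finType) (Z : I -> {RV Pr >-> T}).
Implicit Types (J K : {set I}) (A : I -> set T).
Local Open Scope ereal_scope.

Lemma generated_by_sub_measurable J : generated_by Z J `<=` measurable.
Proof.
apply: smallest_sub; first exact: sigma_algebra_measurable.
move=> _ [i _ [B mB <-]]; rewrite setTI -[X in measurable X]setTI.
exact: measurable_funPT.
Qed.

Lemma generated_by_preimage J i b : i \in J -> measurable b ->
  generated_by Z J (Z i @^-1` b).
Proof.
by move=> iJ mb; apply: sub_gen_smallest; exists i => //; exists b; rewrite ?setTI.
Qed.

Lemma generated_byS J K : J \subset K -> generated_by Z J `<=` generated_by Z K.
Proof.
move=> /fintype.subsetP JK; apply: smallest_sub.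
  exact: smallest_sigma_algebra.
by apply: sub_smallest => a [i /= /JK iK Za]; exists i.
Qed.

(** Unlike the preimages that define [generated_by], finite-dimensional
cylinders form a pi-system, on which mutual independence is the product rule. *)
Definition cylinder J : set (set Omega) :=
  [set a | exists A, (forall i, measurable (A i)) /\
     a = \bigcap_(i in [set` J]) Z i @^-1` A i].

Lemma cylinder_measurable J : cylinder J `<=` measurable.
Proof.
move=> _ [A [mA ->]]; apply: fin_bigcap_measurable => // i _.
by rewrite -[X in measurable X]setTI; exact: measurable_funPT.
Qed.

Lemma cylinder_setI_closed J : setI_closed (cylinder J).
Proof.
move=> _ _ [A [mA ->]] [B [mB ->]]; exists (fun i => A i `&` B i); split.
  by move=> i; exact: measurableI.
by rewrite -bigcapI.
Qed.

Lemma generated_by_cylinder J : generated_by Z J `<=` <<s cylinder J >>.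
Proof.
apply: smallest_sub; first exact: smallest_sigma_algebra.
apply: sub_smallest => _ [i /= iJ [B mB <-]]; rewrite setTI.
exists (fun j => if j == i then B else setT); split.
  by move=> j; case: ifP.
apply/seteqP; split => [w Bw j _ /=|w /(_ i iJ) /=]; last by rewrite eqxx.
by case: ifP => // /eqP ->.
Qed.

Lemma independent_cylinders J K L : mutually_independent Z L ->
  J \subset L -> K \subset L -> [disjoint J & K]%B ->
  independent_classes Pr (cylinder J) (cylinder K).
Proof.
move=> ZL JL KL dJK _ _ [A [mA ->]] [B [mB ->]].
(* One cylinder over the union, to which mutual independence applies. *)
pose D i := if i \in J then A i else B i.
have mD i : measurable (D i) by rewrite /D; case: ifP.
have DJ i : i \in J -> D i = A i by rewrite /D => ->.
have DK i : i \in K -> D i = B i.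
  by move=> iK; rewrite /D (disjointFl dJK).
have -> : \bigcap_(i in [set` J]) Z i @^-1` A i `&`
    \bigcap_(i in [set` K]) Z i @^-1` B i =
    \bigcap_(i in [set` (J :|: K)%SET]) Z i @^-1` D i.
  apply/seteqP; split => [w [wA wB] i /=|w wD].
    rewrite finset.in_setU => /orP[iJ|iK].
      by rewrite DJ//; exact: (wA i iJ).
    by rewrite DK//; exact: (wB i iK).
  split=> i /= iJ.
    by rewrite -DJ//; apply: wD; rewrite /= finset.in_setU iJ.
  by rewrite -DK//; apply: wD; rewrite /= finset.in_setU iJ orbT.
rewrite !ZL ?finset.subUset ?JL//.
rewrite (eq_bigl [predU J & K]); last by move=> i; rewrite finset.in_setU.
rewrite bigU//=; congr (_ * _).
  by apply: eq_bigr => i iJ; rewrite DJ.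
by apply: eq_bigr => i iJ; rewrite DK.
Qed.

(** Only the product rule between whole sigma-algebras is available for the
outliers, so their joint sigma-algebra with some informative data is generated
by intersections of one event of each kind. *)
Lemma generated_by_setU J K : generated_by Z (J :|: K)%SET `<=`
  <<s [set a | exists b c, [/\ generated_by Z J b, generated_by Z K c &
                           a = b `&` c]] >>.
Proof.
have gT L : generated_by Z L setT.
  by rewrite -setC0 -setTD; apply: sigma_algebraCD; exact: sigma_algebra0.
apply: smallest_sub; first exact: smallest_sigma_algebra.
apply: sub_smallest => a [i /=]; rewrite finset.in_setU => /orP[iJ|iK] Za.
- exists a, setT; split => //; last by rewrite setIT.
  by apply: sub_gen_smallest; exists i.
- exists setT, a; split => //; last by rewrite setTI.
  by apply: sub_gen_smallest; exists i.
Qed.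

Lemma generated_by_setI_closed J : setI_closed (generated_by Z J).
Proof. by move=> a b; exact: (@measurableI _ (g_sigma_algebraType _)). Qed.

Lemma informative_independent J K L : mutually_independent Z L ->
  J \subset L -> K \subset L -> [disjoint J & K]%B ->
  independent_subfamilies Z J K.
Proof.
move=> ZL JL KL dJK a b Ja Kb.
apply: (independent_classes_generated _ _ _ _ (independent_cylinders ZL JL KL dJK)).
- exact: cylinder_measurable.
- exact: cylinder_measurable.
- exact: cylinder_setI_closed.
- exact: cylinder_setI_closed.
- exact: generated_by_cylinder.
- exact: generated_by_cylinder.
Qed.

(** Split an event of J into an outlier part x and an informative part y. The
events y and b are both informative, so that P(x y b) = P(x) P(y b), and
the mutual independence of the informative data separates y from b. *)
Lemma disjoint_independent (O J K : {set I}) :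
    mutually_independent Z (~: O)%SET ->
    independent_subfamilies Z O (~: O)%SET ->
    K \subset (~: O)%SET -> [disjoint J & K]%B ->
  independent_subfamilies Z J K.
Proof.
move=> ZO ZOC KO dJK a b Ja Kb.
have mb := generated_by_sub_measurable Kb.
have {}Ja : generated_by Z ((J :&: O) :|: (J :\: O))%SET a by rewrite finset.setID.
apply: (independent_event_generated _ _ mb _ (generated_by_setU Ja)).
- move=> _ [x [y [Jx Jy ->]]]; apply: measurableI.
    exact: generated_by_sub_measurable Jx.
  exact: generated_by_sub_measurable Jy.
- move=> _ _ [x [y [Jx Jy ->]]] [x' [y' [Jx' Jy' ->]]].
  exists (x `&` x'), (y `&` y'); split; [| |by rewrite setIACA];
    exact: generated_by_setI_closed.
- move=> _ [x [y [Jx Jy ->]]].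
  have Ox : generated_by Z O x := generated_byS (finset.subsetIr _ _) Jx.
  have sJO : (J :\: O \subset ~: O)%SET by rewrite finset.setDE finset.subsetIr.
  have Iy := generated_byS sJO Jy; have Ib := generated_byS KO Kb.
  rewrite -setIA (ZOC x (y `&` b))//; last exact: generated_by_setI_closed.
  rewrite (ZOC x y)//.
  rewrite (informative_independent ZO sJO KO) ?muleA//.
  exact: disjointWl (finset.subsetDl _ _) dJK.
Qed.

(** The events A v are revealed one at a time: A v depends on a common part J and
on its own part B v, and has conditional probability at most p given anything
that avoids B v. The induction carries along the measurability of the
intersection with respect to the data seen so far. *)
Lemma adaptive_product_bound (V : finType) (J : {set I}) (B : V -> {set I})
    (A : V -> set Omega) (p : R) (s : {set V}) : (0 <= p)%R ->
    (forall u v, u \in s -> v \in s -> u != v -> [disjoint B u & B v]%B) ->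
    (forall v, v \in s -> [disjoint J & B v]%B) ->
    (forall v, v \in s -> generated_by Z (J :|: B v)%SET (A v)) ->
    (forall v (J0 : {set I}) E, v \in s -> J \subset J0 ->
       [disjoint J0 & B v]%B -> generated_by Z J0 E ->
       Pr (E `&` A v) <= p%:E * Pr E) ->
  Pr (\bigcap_(v in [set` s]) A v) <= (p ^+ #|s|)%:E.
Proof.
move=> p0 B_disj B_test A_gen A_step.
have -> : \bigcap_(v in [set` s]) A v = \big[setI/setT]_(v <- enum s) A v.
  rewrite -bigcap_seq; apply/seteqP; split=> w Aw v /= vs; apply: Aw => /=.
    by rewrite -mem_enum.
  by rewrite mem_enum.
pose seen (l : seq V) := (J :|: \bigcup_(v <- l) B v)%SET.
have sub v : v \in enum s -> v \in s by rewrite mem_enum.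
rewrite cardE; move: (enum s) (enum_uniq s) sub => l ul sub.
suff [] : generated_by Z (seen l) (\big[setI/setT]_(v <- l) A v) /\
    (Pr (\big[setI/setT]_(v <- l) A v) <= (p ^+ size l)%:E)%E by [].
elim: l ul sub => [_ _|v l IH /= /andP[vl ul] sub].
  rewrite big_nil probability_setT; split=> //.
  exact: (@measurableT _ (g_sigma_algebraType _)).
have vs : v \in s by apply: sub; rewrite mem_head.
have [||gen le] := IH.
- exact: ul.
- by move=> u ul'; apply: sub; rewrite inE ul' orbT.
have disj : [disjoint seen l & B v]%B.
  rewrite finset.disjoints_subset finset.subUset -!finset.disjoints_subset B_test//=.
  rewrite finset.disjoints_subset big_seq.
  apply: (big_ind (fun D : {set I} => D \subset (~: B v)%SET)).
  - exact: finset.sub0set.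
  - by move=> D D' BD BD'; rewrite finset.subUset BD.
  - move=> u ul'; rewrite -finset.disjoints_subset B_disj//.
      by apply: sub; rewrite inE ul' orbT.
    by apply: contraNneq vl => <-.
rewrite big_cons setIC; split.
  apply: generated_by_setI_closed.
    apply: generated_byS gen; rewrite /seen big_cons.
    by rewrite finset.setUS// finset.subsetUr.
  apply: generated_byS (A_gen v vs); rewrite /seen big_cons.
  by rewrite finset.setUS// finset.subsetUl.
apply: le_trans (A_step v _ _ vs _ disj gen) _; first exact: finset.subsetUl.
by rewrite exprS EFinM lee_wpmul2l// lee_fin.
Qed.

End disjoint_subfamilies.

(** * Freezing one of two independent variables *)

Section independent_maps.
Context d d1 d2 (Omega : measurableType d) (S : measurableType d1)
  (T : measurableType d2) (R : realType).
Variables (Pr : probability Omega R) (U : {mfun Omega >-> S})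
  (W : {mfun Omega >-> T}).
Local Open Scope ereal_scope.

Hypothesis UW : forall a b, measurable a -> measurable b ->
  Pr (U @^-1` a `&` W @^-1` b) = Pr (U @^-1` a) * Pr (W @^-1` b).

Let pairUW : {mfun Omega >-> (S * T)%type} :=
  mfun_Sub (mem_set (measurable_fun_pair (measurable_funPT U) (measurable_funPT W))).

(** Two measures that agree on rectangles are equal. *)
Lemma joint_law D : measurable D ->
  (distribution Pr U \x distribution Pr W) D = Pr [set w | D (U w, W w)].
Proof.
move=> mD.
by rewrite (@product_measure_unique _ _ _ _ _ (distribution Pr U)
  (distribution Pr W) (distribution Pr pairUW)).
Qed.

(** A conditional probability bound that is uniform in the frozen value x of U
survives integration over any event of U. *)
Lemma freezing (a : set S) (D : set (S * T)) (p : R) :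
    measurable a -> measurable D -> (0 <= p)%R ->
    (forall x, Pr [set w | D (x, W w)] <= p%:E) ->
  Pr [set w | a (U w) /\ D (U w, W w)] <= p%:E * Pr (U @^-1` a).
Proof.
move=> ma mD p0 Dp.
have maD : measurable ((a `*` setT) `&` D).
  by apply: measurableI => //; exact: measurableX.
have -> : [set w | a (U w) /\ D (U w, W w)] =
    [set w | ((a `*` setT) `&` D) (U w, W w)].
  by apply/seteqP; split=> [w []//|w /= [[? _] ?]].
rewrite -joint_law//= /product_measure1/=.
have -> : p%:E * Pr (U @^-1` a) =
    \int[distribution Pr U]_x (p%:E * (\1_a x)%:E).
  rewrite ge0_integralZl_EFin//; first by rewrite integral_indic// setIT.
  by apply/measurable_EFinP; exact: measurable_indic.
apply: ge0_le_integral => //.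
- exact: (measurable_fun_xsection (distribution Pr W) maD).
- by apply: measurable_funeM; apply/measurable_EFinP; exact: measurable_indic.
- move=> x _ /=; rewrite indicE; have [/set_mem ax|/negP xa] := boolP (x \in a).
    rewrite mule1; apply: le_trans (Dp x); apply: (@le_measure _ _ _ Pr); rewrite ?inE.
    + exact: measurable_funPTI (measurable_xsection x maD).
    + rewrite [X in measurable X](_ : _ = W @^-1` xsection D x).
        exact: measurable_funPTI (measurable_xsection x mD).
      by apply/seteqP; split=> w; rewrite /xsection/= inE.
    + by move=> w /=; rewrite /xsection/= !inE => -[].
  rewrite mule0 [X in distribution _ _ X](_ : _ = set0) ?measure0//.
  apply/seteqP; split=> // y; rewrite /xsection/= inE => -[[/= ax _] _].
  by apply: xa; rewrite inE.
Qed.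

Lemma independent_expectationM (f : S -> R) (g : T -> R) :
    measurable_fun setT f -> measurable_fun setT g ->
    f \o U \in Lfun Pr 1 -> g \o W \in Lfun Pr 1 ->
    ((f \o U) \* (g \o W))%R \in Lfun Pr 1 ->
  'E_Pr[(f \o U) \* (g \o W)] = 'E_Pr[f \o U] * 'E_Pr[g \o W].
Proof.
move=> mf mg /Lfun1_integrable fU /Lfun1_integrable gW /Lfun1_integrable fgUW.
rewrite unlock.
pose F (z : S * T) := (f z.1 * g z.2)%:E.
have mF : measurable_fun setT F.
  apply/measurable_EFinP; apply: measurable_funM.
    exact: measurableT_comp mf measurable_fst.
  exact: measurableT_comp mg measurable_snd.
have mfE : measurable_fun setT (EFin \o f) by exact/measurable_EFinP.
have mgE : measurable_fun setT (EFin \o g) by exact/measurable_EFinP.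
have E : forall D, measurable D ->
    (distribution Pr U \x distribution Pr W) D = distribution Pr pairUW D.
  by move=> D mD; rewrite joint_law.
have -> : \int[Pr]_w (((f \o U) \* (g \o W))%R w)%:E =
    \int[Pr]_w (F \o pairUW) w by [].
rewrite -(integral_distribution (X := pairUW))//.
rewrite -(integral_distribution (X := U) mfE fU).
rewrite -(integral_distribution (X := W) mgE gW).
have gW' : (distribution Pr W).-integrable setT (EFin \o g).
  exact: (integrable_pushforward _ mgE).
have fU' : (distribution Pr U).-integrable setT (EFin \o f).
  exact: (integrable_pushforward _ mfE).
have Fprod : (distribution Pr U \x distribution Pr W).-integrable setT F.
  apply/integrableP; split => //.
  rewrite (eq_measure_integral (distribution Pr pairUW)); last by move=> D mD _; exact: E.
  have : (distribution Pr pairUW).-integrable setT F.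
    exact: (integrable_pushforward _ mF).
  by case/integrableP.
rewrite (eq_measure_integral (distribution Pr U \x distribution Pr W)); last first.
  by move=> D mD _; apply/esym/E.
rewrite -integral12_prod_meas1// /fubini_F /F/=.
under eq_integral => x _ do under eq_integral => y _ do rewrite EFinM.
under eq_integral => x _ do rewrite integralZl//.
have gfin := integrable_fin_num measurableT gW'.
rewrite -[X in _ = _ * X](fineK gfin) -integralZr//.
by apply: eq_integral => x _; rewrite fineK.
Qed.

End independent_maps.

(** * Chebyshev's inequality for empirical means *)

Section square_integrable.
Context d (T : measurableType d) (R : realType) (P : probability T R).
Implicit Types (f g : T -> R).
Local Open Scope ereal_scope.

Lemma Lfun_measurable p f : f \in Lfun P p -> measurable_fun setT f.
Proof. by rewrite inE => /andP[/[!inE]]. Qed.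

Lemma sqr_Lfun2 f : measurable_fun setT f ->
  'E_P[fun x => f x ^+ 2]%R < +oo -> f \in Lfun P 2%:E.
Proof.
move=> mf; rewrite unlock => f2.
apply/andP; split; rewrite inE//=.
rewrite /finite_norm unlock poweR_lty//.
apply: le_lt_trans f2; rewrite le_eqVlt; apply/orP; left; apply/eqP.
apply: eq_integral => x _ /=.
by rewrite powR_mulrn// real_normK// num_real.
Qed.

Lemma Lfun2_sqr f : f \in Lfun P 2%:E -> 'E_P[fun x => f x ^+ 2]%R < +oo.
Proof.
by move=> /Lfun2_integrable_sqr /integrable_lty; rewrite unlock; apply.
Qed.

Lemma Lfun21 f : f \in Lfun P 2%:E -> f \in Lfun P 1.
Proof. by apply: Lfun_subset12; exact: fin_num_measure. Qed.

Lemma Lfun2_sqr1 f : f \in Lfun P 2%:E -> (fun x => f x ^+ 2)%R \in Lfun P 1.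
Proof. by move=> f2; exact: Lfun2_mul_Lfun1. Qed.

Lemma le_variance_expectation f : f \in Lfun P 2%:E ->
  'V_P[f] <= 'E_P[fun x => f x ^+ 2]%R.
Proof.
move=> f2; rewrite varianceE// leeBlDr ?leeDl ?sqre_ge0//.
by rewrite fin_numX// expectation_fin_num// Lfun21.
Qed.

End square_integrable.

Section uncorrelated.
Context d (T : measurableType d) (R : realType) (P : probability T R).
Context (I : eqType).
Local Open Scope ereal_scope.

Lemma Lfun2_sum (s : seq I) (X : I -> T -> R) :
  (forall i, i \in s -> X i \in Lfun P 2%:E) ->
  (\sum_(i <- s) X i)%R \in Lfun P 2%:E.
Proof. by move=> X2; rewrite big_seq rpred_sum ?lee1n// => i /X2. Qed.

Lemma variance_sum_uncorrelated (s : seq I) (X : I -> T -> R) : uniq s ->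
    (forall i, i \in s -> X i \in Lfun P 2%:E) ->
    (forall i j, i \in s -> j \in s -> i != j -> covariance P (X i) (X j) = 0) ->
  'V_P[(\sum_(i <- s) X i)%R] = \sum_(i <- s) 'V_P[X i].
Proof.
elim: s => [_ _ _|i s IH /= /andP[si us] X2 X0].
  by rewrite !big_nil (variance_cst P 0).
have X2s j : j \in s -> X j \in Lfun P 2%:E.
  by move=> js; apply: X2; rewrite inE js orbT.
have Xi : X i \in Lfun P 2%:E by apply: X2; rewrite mem_head.
rewrite !big_cons varianceD//; last exact: Lfun2_sum.
rewrite IH//; last by move=> j k js ks; apply: X0; rewrite inE ?js ?ks orbT.
suff -> : covariance P (X i) (\sum_(j <- s) X j)%R = 0 by rewrite mule0 adde0.
have Xs j : j \in s -> covariance P (X i) (X j) = 0.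
  move=> js; apply: X0; rewrite ?mem_head// ?inE ?js ?orbT//.
  by apply: contraNneq si => ->.
elim: s {si us X0 IH X2} X2s Xs => [_ _|j s IH X2s Xs].
  by rewrite big_nil (covariance_cst_r P _ 0).
rewrite big_cons covarianceDr//; first last.
- by apply: Lfun2_sum => k ks; apply: X2s; rewrite inE ks orbT.
- by apply: X2s; rewrite mem_head.
rewrite Xs ?mem_head// IH ?adde0// => k ks; first by apply: X2s; rewrite inE ks orbT.
by apply: Xs; rewrite inE ks orbT.
Qed.

End uncorrelated.

Section iid_sample.
Context d d' (Omega : measurableType d) (T : measurableType d') (R : realType).
Variables (Pr : probability Omega R) (I : finType) (Z : I -> {RV Pr >-> T}).
Variables (L : {set I}) (P : probability T R).
Hypothesis ZP : iid_on Z L P.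
Local Open Scope ereal_scope.

Lemma iid_ge0_expectation i (f : T -> R) : i \in L -> measurable_fun setT f ->
  (forall x, 0 <= f x)%R -> 'E_Pr[f \o Z i] = 'E_P[f].
Proof.
move=> iL mf f0; rewrite unlock.
rewrite -(ge0_integral_distribution (Z i) (f := EFin \o f)).
- by apply: eq_measure_integral => A mA _; exact: ZP.2.
- exact/measurable_EFinP.
- by move=> y; rewrite /= lee_fin.
Qed.

Lemma iid_Lfun2 i (f : T -> R) : i \in L -> f \in Lfun P 2%:E ->
  f \o Z i \in Lfun Pr 2%:E.
Proof.
move=> iL f2; have mf := Lfun_measurable f2.
apply: sqr_Lfun2; first exact: measurableT_comp.
have := @iid_ge0_expectation i (fun x => f x ^+ 2)%R iL.
rewrite /comp => -> //; first exact: Lfun2_sqr.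
- exact: measurable_funX.
- by move=> x; exact: sqr_ge0.
Qed.

Lemma iid_expectation i (f : T -> R) : i \in L -> f \in Lfun P 2%:E ->
  'E_Pr[f \o Z i] = 'E_P[f].
Proof.
move=> iL f2; have mf := Lfun_measurable f2.
have /Lfun21/Lfun1_integrable fZ := iid_Lfun2 iL f2.
rewrite unlock -(integral_distribution (X := Z i) (f := EFin \o f))//.
- by apply: eq_measure_integral => A mA _; exact: ZP.2.
- exact/measurable_EFinP.
Qed.

Lemma iid_covariance i j (f : T -> R) : i \in L -> j \in L -> i != j ->
  f \in Lfun P 2%:E -> covariance Pr (f \o Z i) (f \o Z j) = 0.
Proof.
move=> iL jL ij f2; have mf := Lfun_measurable f2.
have fi := iid_Lfun2 iL f2; have fj := iid_Lfun2 jL f2.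
have fij := Lfun2_mul_Lfun1 fi fj.
have fi1 := Lfun21 fi; have fj1 := Lfun21 fj.
rewrite covarianceE//.
rewrite (@independent_expectationM _ _ _ _ _ _ _ Pr (Z i) (Z j))//.
  by rewrite subee// fin_numM ?expectation_fin_num.
move=> a b ma mb.
apply: (informative_independent ZP.1 (J := [set i]%SET) (K := [set j]%SET)).
- by rewrite finset.sub1set.
- by rewrite finset.sub1set.
- by rewrite disjoints1 finset.in_set1.
- by apply: generated_by_preimage; rewrite ?finset.in_set1.
- by apply: generated_by_preimage; rewrite ?finset.in_set1.
Qed.

(** The informative data are uncorrelated with a common law, so the variance of
their mean is at most the second moment of f divided by the size of B. *)
Lemma empirical_mean_deviation (B : {set I}) (f : T -> R) (t : R) :
    B \subset L -> (0 < #|B|)%N -> (0 < t)%R -> f \in Lfun P 2%:E ->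
  Pr [set w | (t <= `| #|B|%:R^-1 * \sum_(i in B) f (Z i w) - fine 'E_P[f]|)%R]
    <= (fine 'E_P[fun x => f x ^+ 2]%R / (#|B|%:R * t ^+ 2))%:E.
Proof.
move=> /fintype.subsetP BL B0 t0 f2.
have n0 : (0 < #|B|%:R :> R)%R by rewrite ltr0n.
pose X i : Omega -> R := f \o Z i.
pose S := (\sum_(i <- enum B) X i)%R.
have X2 i : i \in enum B -> X i \in Lfun Pr 2%:E.
  by rewrite mem_enum => /BL iL; exact: iid_Lfun2.
have S2 : S \in Lfun Pr 2%:E by exact: Lfun2_sum.
have fE : 'E_P[f] \is a fin_num by rewrite expectation_fin_num// Lfun21.
have SE : fine 'E_Pr[S] = (#|B|%:R * fine 'E_P[f])%R.
  have -> : 'E_Pr[S] = \sum_(i in B) 'E_P[f].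
    rewrite /S -(big_map X xpredT id) expectation_sum.
      rewrite big_map big_enum/=; apply: eq_bigr => i iB.
      by rewrite iid_expectation// BL.
    by move=> _ /mapP[i iB ->]; exact/Lfun21/X2.
  by rewrite -sum_fine// sumr_const mulr_natl.
have SV : 'V_Pr[S] <= (#|B|%:R * fine 'E_P[fun x => f x ^+ 2]%R)%:E.
  rewrite variance_sum_uncorrelated ?enum_uniq//; last first.
    move=> i j; rewrite !mem_enum => /BL iL /BL jL ij; exact: iid_covariance.
  have -> : (#|B|%:R * fine 'E_P[fun x => f x ^+ 2]%R)%:E =
      \sum_(i <- enum B) 'E_P[fun x => f x ^+ 2]%R.
    rewrite big_enum/= mulr_natl -sumr_const -sumEFin.
    by apply: eq_bigr => i _; rewrite fineK// expectation_fin_num// Lfun2_sqr1.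
  rewrite [leLHS]big_seq [leRHS]big_seq; apply: lee_sum => i iB.
  apply: le_trans (le_variance_expectation (X2 i iB)) _.
  have iL : i \in L by apply: BL; rewrite -mem_enum.
  rewrite -(@iid_ge0_expectation i (fun x => f x ^+ 2)%R)//.
    exact/measurable_funX/(Lfun_measurable f2).
  by move=> x; exact: sqr_ge0.
pose SX : {mfun Omega >-> R} := mfun_Sub (mem_set (Lfun_measurable S2)).
have nt0 : (0 < #|B|%:R * t)%R by rewrite mulr_gt0.
have := chebyshev (P := Pr) SX nt0.
rewrite -/S => /le_trans.
have -> : [set w | (t <= `| #|B|%:R^-1 * \sum_(i in B) f (Z i w) - fine 'E_P[f]|)%R]
    = [set w | (#|B|%:R * t <= `|SX w - fine 'E_Pr[SX]|)%R].
  apply/seteqP.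
  have E w : (`| SX w - fine 'E_Pr[S]| =
     #|B|%:R * `| #|B|%:R^-1 * \sum_(i in B) f (Z i w) - fine 'E_P[f]|)%R.
    rewrite SE (_ : SX w = \sum_(i in B) f (Z i w))%R; last first.
      by rewrite /SX/= /S fct_sumE big_enum.
    rewrite -[X in (_ = X * _)%R](gtr0_norm n0) -normrM; congr (`|_|)%R.
    by field; rewrite gt_eqF.
  by split=> w /=; rewrite E ler_pM2l.
apply; apply: le_trans (lee_wpmul2l _ SV) _; first by rewrite lee_fin invr_ge0 sqr_ge0.
rewrite -EFinM lee_fin le_eqVlt; apply/orP; left; apply/eqP.
by field; rewrite !gt_eqF.
Qed.

End iid_sample.

(** * Least squares over a linear model *)

Section inner_product.
Context d (T : measurableType d) (R : realType) (P : probability T R).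
Implicit Types (u v : T -> R).

(** The L^2 inner product as a real number; it is meaningful for square-integrable
arguments only, where [innerE] recovers the expectation. *)
Definition inner u v : R := fine 'E_P[u \* v]%E.

Lemma innerE u v : u \in Lfun P 2%:E -> v \in Lfun P 2%:E ->
  'E_P[u \* v]%E = (inner u v)%:E.
Proof.
by move=> u2 v2; rewrite fineK// expectation_fin_num// Lfun2_mul_Lfun1.
Qed.

Lemma inner_ge0 u : 0 <= inner u u.
Proof. by apply/fine_ge0/expectation_ge0 => x /=; rewrite -expr2 sqr_ge0. Qed.

Lemma Lfun2_addZ t u v : u \in Lfun P 2%:E -> v \in Lfun P 2%:E ->
  (fun x => u x + t * v x) \in Lfun P 2%:E.
Proof.
move=> u2 v2.
have -> : (fun x => u x + t * v x) = u + t \o* v.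
  by apply/funext => x /=; rewrite [t * _]mulrC.
by rewrite rpredD ?lee1n//= Lfun_scale// ler1n.
Qed.

Lemma inner_sqr_addZ t u v : u \in Lfun P 2%:E -> v \in Lfun P 2%:E ->
  inner (fun x => u x + t * v x) (fun x => u x + t * v x) =
    inner u u + 2 * t * inner u v + t ^+ 2 * inner v v.
Proof.
move=> u2 v2; apply: EFin_inj; rewrite -innerE; [|exact: Lfun2_addZ..].
have uu := Lfun2_mul_Lfun1 u2 u2; have uv := Lfun2_mul_Lfun1 u2 v2.
have vv := Lfun2_mul_Lfun1 v2 v2.
have -> : (fun x => u x + t * v x) \* (fun x => u x + t * v x) =
   (u \* u) \+ ((2 * t) \o* (u \* v) \+ (t ^+ 2) \o* (v \* v)).
  by apply/funext => x /=; ring.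
have uvt : (2 * t) \o* (u \* v) \in Lfun P 1 by rewrite Lfun_scale.
have vvt : (t ^+ 2) \o* (v \* v) \in Lfun P 1 by rewrite Lfun_scale.
have s1 : (2 * t) \o* (u \* v) \+ (t ^+ 2) \o* (v \* v) \in Lfun P 1 by rewrite rpredD.
by rewrite !expectationD// !expectationZl// !innerE// !EFinD !EFinM addeA.
Qed.

(** If u is shortest on the line u + t v, the quadratic polynomial
2 t <u, v> + t^2 <v, v> is nonnegative for all t, which kills its linear
coefficient. *)
Lemma minimal_orthogonal u v : u \in Lfun P 2%:E -> v \in Lfun P 2%:E ->
    (forall t, inner u u <=
       inner (fun x => u x + t * v x) (fun x => u x + t * v x)) ->
  inner u v = 0.
Proof.
move=> u2 v2 umin.
have {}umin t : 0 <= 2 * t * inner u v + t ^+ 2 * inner v v.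
  by have := umin t; rewrite inner_sqr_addZ// -addrA lerDl.
have [v0|v0] := eqVneq (inner v v) 0.
  have := umin (- inner u v); rewrite v0 => h.
  apply/eqP; rewrite -sqrf_eq0 eq_le sqr_ge0 andbT; lra.
have vpos : 0 < inner v v by rewrite lt_neqAle eq_sym v0 inner_ge0.
(* the minimizer of the quadratic polynomial *)
have := umin (- (inner u v / inner v v)).
have -> : 2 * - (inner u v / inner v v) * inner u v +
   (- (inner u v / inner v v)) ^+ 2 * inner v v = - (inner u v ^+ 2 / inner v v).
  by field.
rewrite oppr_ge0 => h; apply/eqP; rewrite -sqrf_eq0 eq_le sqr_ge0 andbT.
by rewrite -(pmulr_lle0 _ (_ : 0 < (inner v v)^-1)) ?invr_gt0.
Qed.

End inner_product.

Section least_squares.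
Context d (X : measurableType d) (R : realType) (P : probability (X * R)%type R).
Hypothesis P_Y2 : ('E_P[(fun z : X * R => (z.2 ^+ 2)%R)] < +oo)%E.
Variable F : {pred X -> R}.
Hypothesis F_L2 : {subset F <= Lfun (marginalX P) 2%:E}.
Hypothesis F_lin : submod_closed F.
Variable fstar : X -> R.
Hypothesis fstar_oracle : is_oracle P F fstar.
Implicit Types f g : X -> R.

(** The squared distance to the oracle. By [excess_riskE] it is the excess risk on
the model; unlike a difference of two risks it is nonnegative by definition, and
Tonelli's theorem applies to it directly. *)
Definition regret f : R :=
  fine 'E_P[(fun z : X * R => ((f z.1 - fstar z.1) ^+ 2)%R)]%E.

Local Notation resid := (fun z : X * R => z.2 - fstar z.1).

Lemma F_linear t f g : f \in F -> g \in F -> (fun x => g x + t * f x) \in F.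
Proof.
move=> fF gF; have := F_lin.2 t f g fF gF.
by congr (_ \in F); apply/funext => x /=; rewrite addrC.
Qed.

Lemma F_sub f g : f \in F -> g \in F -> (fun x => f x - g x) \in F.
Proof.
move=> fF gF; have := F_linear (- 1) gF fF.
by congr (_ \in F); apply/funext => x /=; rewrite mulN1r.
Qed.

Lemma F_measurable f : f \in F -> measurable_fun setT f.
Proof. by move=> /F_L2; exact: Lfun_measurable. Qed.

Lemma F_Lfun2 f : f \in F -> (fun z : X * R => f z.1) \in Lfun P 2%:E.
Proof.
move=> fF; have mf := F_measurable fF.
apply: sqr_Lfun2; first exact: measurableT_comp mf measurable_fst.
have := Lfun2_sqr (F_L2 fF); rewrite unlock.
rewrite (ge0_integral_distribution (mfun_fst X R : {RV P >-> X})
  (f := fun x => (f x ^+ 2)%:E))//.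
- by apply/measurable_EFinP; exact: measurable_funX.
- by move=> x; rewrite lee_fin sqr_ge0.
Qed.

Lemma Y_Lfun2 : (snd : X * R -> R) \in Lfun P 2%:E.
Proof. by apply: sqr_Lfun2 => //; exact: measurable_snd. Qed.

Lemma residual_Lfun2 f : f \in F -> (fun z : X * R => z.2 - f z.1) \in Lfun P 2%:E.
Proof.
move=> fF; have -> : (fun z : X * R => z.2 - f z.1) = (fun z => z.2 + (- 1) * f z.1).
  by apply/funext => z; rewrite mulN1r.
by apply: Lfun2_addZ; [exact: Y_Lfun2|exact: F_Lfun2].
Qed.

Lemma resid_Lfun2 : resid \in Lfun P 2%:E.
Proof. exact: residual_Lfun2 fstar_oracle.1. Qed.

Lemma risk_shift t f : f \in F -> risk P (fun x => fstar x - t * f x) =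
  (inner P (fun z => resid z + t * f z.1) (fun z => resid z + t * f z.1))%:E.
Proof.
move=> fF; rewrite -innerE; [|by apply: Lfun2_addZ; [exact: resid_Lfun2|exact: F_Lfun2]..].
by congr expectation; apply/funext => z /=; rewrite /gamma; ring.
Qed.

Lemma risk_fstar : risk P fstar = (inner P resid resid)%:E.
Proof. by rewrite -innerE ?resid_Lfun2//; congr expectation. Qed.

(** Moving from the oracle along a direction of the model cannot decrease the
risk, which is the squared norm of the residual. *)
Lemma resid_orthogonal f : f \in F -> inner P resid (fun z => f z.1) = 0.
Proof.
move=> fF; apply: minimal_orthogonal => [||t].
- exact: resid_Lfun2.
- exact: F_Lfun2.
rewrite -lee_fin -risk_shift// -risk_fstar; apply: fstar_oracle.2.
have := F_linear (- t) fF fstar_oracle.1.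
by congr (_ \in F); apply/funext => x; rewrite mulNr.
Qed.

Lemma regret_inner f : regret f =
  inner P (fun z => f z.1 - fstar z.1) (fun z => f z.1 - fstar z.1).
Proof. by []. Qed.

Lemma regret_ge0 f : 0 <= regret f.
Proof. exact: inner_ge0. Qed.

(** Pythagoras: the residual of f is the residual of the oracle minus f - fstar,
and these two are orthogonal. *)
Lemma excess_riskE f : f \in F -> excess_risk P fstar f = (regret f)%:E.
Proof.
move=> fF; have hF := F_sub fF fstar_oracle.1.
rewrite /excess_risk.
have -> : risk P f = risk P (fun x => fstar x - (- 1) * (f x - fstar x)).
  by congr risk; apply/funext => x; ring.
rewrite risk_shift// risk_fstar -EFinB; congr EFin.
rewrite inner_sqr_addZ ?resid_Lfun2 ?(F_Lfun2 hF)//.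
by rewrite (resid_orthogonal hF) regret_inner; ring.
Qed.

End least_squares.

Section loss_differences.
Context d (X : measurableType d) (R : realType) (P : probability (X * R)%type R).
Hypothesis P_Y2 : ('E_P[(fun z : X * R => (z.2 ^+ 2)%R)] < +oo)%E.
Variable F : {pred X -> R}.
Hypothesis F_L2 : {subset F <= Lfun (marginalX P) 2%:E}.
Hypothesis F_lin : submod_closed F.
Variable fstar : X -> R.
Hypothesis fstar_oracle : is_oracle P F fstar.
Variables chi sigma : R.
Hypothesis chi_gt0 : 0 < chi.
Hypothesis F_chi : forall f, f \in F ->
     (poweR 'E_P[(fun z : X * R => (f z.1 ^+ 4)%R)] (4^-1)
      <= chi%:E * poweR 'E_P[(fun z : X * R => (f z.1 ^+ 2)%R)] (2^-1))%E.
Hypothesis F_sigma : forall f, f \in F ->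
     ('E_P[(fun z : X * R => ((z.2 - fstar z.1) ^+ 2 * (f z.1 - fstar z.1) ^+ 2)%R)]
      <= (sigma ^+ 2)%:E * 'E_P[(fun z : X * R => ((f z.1 - fstar z.1) ^+ 2)%R)])%E.
Implicit Types f g : X -> R.

Local Notation regret := (regret P fstar).
Local Notation dev f := (fun z : X * R => f z.1 - fstar z.1).
Local Notation resid := (fun z : X * R => z.2 - fstar z.1).

Lemma regret_EFin f : f \in F -> 'E_P[(fun z => (dev f z) ^+ 2)%R]%E = (regret f)%:E.
Proof.
move=> fF; have := F_Lfun2 F_L2 (F_sub F_lin fF fstar_oracle.1) => h2.
by rewrite fineK// expectation_fin_num// Lfun2_sqr1.
Qed.

(** The L^4-L^2 comparison, applied to f - fstar, which lies in the model. *)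
Lemma fourth_moment f : f \in F ->
  ('E_P[(fun z => (dev f z) ^+ 4)%R] <= (chi ^+ 4 * regret f ^+ 2)%:E)%E.
Proof.
move=> fF; have hF := F_sub F_lin fF fstar_oracle.1.
have := F_chi hF; rewrite regret_EFin// poweR_EFin -EFinM.
have : (0 <= 'E_P[(fun z => (dev f z) ^+ 4)%R])%E.
  by apply: expectation_ge0 => z; rewrite (exprM _ 2 2) sqr_ge0.
(* An infinite fourth moment would make the left-hand side infinite. *)
case: ('E_P[_])%E => [r| |]//; last by rewrite poweRyr// invr_neq0// pnatr_eq0.
rewrite poweR_EFin !lee_fin => r0 h.
have -> : r = (r `^ 4^-1) ^+ 4.
  by rewrite -powR_mulrn ?powR_ge0// -powRrM mulVf// powRr1.
have -> : chi ^+ 4 * regret f ^+ 2 = (chi * regret f `^ 2^-1) ^+ 4.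
  have {1}-> : regret f = (regret f `^ 2^-1) ^+ 2; last by ring.
  rewrite -powR_mulrn ?powR_ge0// -powRrM mulVf// powRr1//.
  exact: regret_ge0.
by rewrite lerXn2r// nnegrE ?mulr_ge0 ?powR_ge0// ltW.
Qed.

Lemma sqr_dev_Lfun2 f : f \in F -> (fun z => (dev f z) ^+ 2) \in Lfun P 2%:E.
Proof.
move=> fF; have /(F_Lfun2 F_L2)/Lfun_measurable mh := F_sub F_lin fF fstar_oracle.1.
apply: sqr_Lfun2; first exact: measurable_funX.
have -> : (fun x => (dev f x ^+ 2) ^+ 2) = (fun x => dev f x ^+ 4).
  by apply/funext => z; rewrite -exprM.
exact: le_lt_trans (fourth_moment fF) (ltry _).
Qed.

Lemma inner_sqr_dev f : f \in F ->
  inner P (fun z => (dev f z) ^+ 2) (fun z => (dev f z) ^+ 2) <= chi ^+ 4 * regret f ^+ 2.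
Proof.
move=> fF; rewrite -lee_fin -innerE ?sqr_dev_Lfun2//.
apply: le_trans (fourth_moment fF); rewrite le_eqVlt; apply/orP; left; apply/eqP.
by congr expectation; apply/funext => z /=; ring.
Qed.

Lemma dist_le_regrets f g : f \in F -> g \in F ->
  inner P (fun z => f z.1 - g z.1) (fun z => f z.1 - g z.1)
    <= 2 * (regret f + regret g).
Proof.
move=> fF gF.
have f2 := F_Lfun2 F_L2 (F_sub F_lin fF fstar_oracle.1).
have g2 := F_Lfun2 F_L2 (F_sub F_lin gF fstar_oracle.1).
have -> : (fun z : X * R => f z.1 - g z.1) = (fun z => dev f z + (- 1) * dev g z).
  by apply/funext => z; ring.
have := inner_ge0 P (fun z => dev f z + 1 * dev g z).
rewrite !inner_sqr_addZ// -!regret_inner; lra.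
Qed.

(** The noise assumption is stated for differences with the oracle; the predictor
fstar + (f - g) brings f - g into this form. *)
Lemma cross_Lfun2 f g : f \in F -> g \in F ->
  (fun z => resid z * (f z.1 - g z.1)) \in Lfun P 2%:E /\
  inner P (fun z => resid z * (f z.1 - g z.1)) (fun z => resid z * (f z.1 - g z.1))
    <= sigma ^+ 2 * (2 * (regret f + regret g)).
Proof.
move=> fF gF; have fgF := F_sub F_lin fF gF.
have kF := F_linear F_lin 1 fgF fstar_oracle.1.
have := F_sigma kF.
rewrite [X in ('E_P[X] <= _)%E](_ : _ = fun z => (resid z * (f z.1 - g z.1)) ^+ 2); last first.
  by apply/funext => z /=; ring.
rewrite [X in (_ <= _ * 'E_P[X])%E](_ : _ =
    (fun z => f z.1 - g z.1) \* (fun z => f z.1 - g z.1)); last first.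
  by apply/funext => z /=; ring.
have e2 := F_Lfun2 F_L2 fgF.
rewrite (innerE e2 e2) => h.
have w2 : (fun z => resid z * (f z.1 - g z.1)) \in Lfun P 2%:E.
  apply: sqr_Lfun2; last exact: le_lt_trans h (ltry _).
  apply: measurable_funM; last exact: (Lfun_measurable (F_Lfun2 F_L2 fgF)).
  exact: (Lfun_measurable (residual_Lfun2 P_Y2 F_L2 fstar_oracle.1)).
split => //; rewrite -lee_fin -innerE//.
apply: le_trans h _; rewrite -EFinM lee_fin ler_wpM2l ?sqr_ge0//.
exact: dist_le_regrets.
Qed.

Definition loss_diff f g (z : X * R) : R := gamma f z - gamma g z.

(** With h = f - fstar, h' = g - fstar and r the residual of the oracle, the
difference of the losses is (h^2 - h'^2) - 2 r (h - h'). The first term is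
controlled by the fourth moments and the second by the noise level. *)
Lemma loss_diff_moments f g : f \in F -> g \in F ->
  [/\ loss_diff f g \in Lfun P 2%:E,
      fine 'E_P[loss_diff f g]%E = regret f - regret g &
      fine 'E_P[fun z => (loss_diff f g z ^+ 2)%R]%E <=
        5 / 2 * chi ^+ 4 * (regret f + regret g) ^+ 2
        + 40 / 3 * sigma ^+ 2 * (regret f + regret g)].
Proof.
move=> fF gF.
have u2 := sqr_dev_Lfun2 fF; have v2 := sqr_dev_Lfun2 gF.
have [w2 ww] := cross_Lfun2 fF gF.
have uu := inner_sqr_dev fF; have vv := inner_sqr_dev gF.
pose u := fun z : X * R => dev f z ^+ 2.
pose v := fun z : X * R => dev g z ^+ 2.
pose w := fun z : X * R => resid z * (f z.1 - g z.1).
have lE : loss_diff f g = fun z => (fun z => u z + (- 1) * v z) z + (- 2) * w z.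
  by apply/funext => z; rewrite /loss_diff /gamma /u /v /w; ring.
have l2 : loss_diff f g \in Lfun P 2%:E by rewrite lE; do !apply: Lfun2_addZ.
split => //.
- have gamma1 h : h \in F -> gamma h \in Lfun P 1.
    by move=> hF; exact: Lfun2_sqr1 (residual_Lfun2 P_Y2 F_L2 hF).
  have risk_fin h : h \in F -> risk P h \is a fin_num.
    by move=> /gamma1; exact: expectation_fin_num.
  have riskE h : h \in F -> fine (risk P h) - fine (risk P fstar) = regret h.
    move=> hF; rewrite -fineB ?risk_fin//; last exact: fstar_oracle.1.
    by rewrite -/(excess_risk _ _ _) (excess_riskE P_Y2 F_L2 F_lin fstar_oracle).
  have -> : loss_diff f g = gamma f \- gamma g by [].
  rewrite expectationB ?gamma1// -!/(risk _ _) fineB ?risk_fin//.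
  by rewrite -!riskE//; ring.
- have -> : fine 'E_P[fun z => (loss_diff f g z ^+ 2)%R]%E =
      inner P (loss_diff f g) (loss_diff f g) by [].
  have a2 : (fun z => u z + (- 1) * v z) \in Lfun P 2%:E by exact: Lfun2_addZ.
  rewrite lE inner_sqr_addZ//.
  (* The weight 4/3 gives (x - 2 w)^2 <= 5/2 x^2 + 20/3 w^2, which balances the
     two terms in the comparison with the constants of the theorem. *)
  have := inner_ge0 P (fun z => (fun z => u z + (- 1) * v z) z + (4 / 3) * w z).
  rewrite !inner_sqr_addZ//.
  have uv0 : 0 <= inner P u v.
    by apply/fine_ge0/expectation_ge0 => z; rewrite mulr_ge0 ?sqr_ge0.
  have := regret_ge0 P fstar f; have := regret_ge0 P fstar g.
  have := exprn_ge0 4 (ltW chi_gt0).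
  move: uu vv ww uv0; rewrite -/u -/v -/w.
  set c := chi ^+ 4; set s2 := sigma ^+ 2.
  set U := inner P u u; set V := inner P v v; set W := inner P w w.
  set UV := inner P u v; set AW := inner P _ w.
  set lf := regret f; set lg := regret g.
  move=> uu vv ww uv0 c0 lg0 lf0 h.
  have cc : 0 <= 2 * (c * lf * lg).
    by apply: mulr_ge0 => //; apply: mulr_ge0 => //; apply: mulr_ge0.
  have uv : U + V <= c * (lf + lg) ^+ 2.
    apply: le_trans (lerD uu vv) _.
    by rewrite -subr_ge0 (_ : _ - _ = 2 * (c * lf * lg))//; ring.
  rewrite -!(mulrA _ c) -!(mulrA _ s2) in uv ww *.
  have {ww}ww : W <= 2 * (s2 * (lf + lg)) by apply: le_trans ww _; rewrite mulrCA.
  move: (c * _) (s2 * (lf + lg)) uv ww => p q uv ww; lra.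
Qed.

End loss_differences.

(** * Measurability with respect to part of the data *)

Section subfamily_information.
Context d d' (Omega : measurableType d) (T : measurableType d') (R : realType).
Variables (Pr : probability Omega R) (I : finType) (Z : I -> {RV Pr >-> T}).
Implicit Types (J K : {set I}).

(** The sample space with the coarser sigma-algebra of the data in J. Using it as
the value space of the identity map turns statements about the training data
into statements about a random variable, without encoding the data as tuples. *)
Definition info J : measurableType _ :=
  g_sigma_algebraType
    (\bigcup_(i in [set` J]) preimage_set_system setT (Z i) measurable).

Lemma measurable_info J i : i \in J ->
  measurable_fun [set: info J] (Z i : info J -> T).
Proof.
move=> iJ _ B mB; rewrite setTI.
exact: (generated_by_preimage (Z := Z) iJ mB).
Qed.

Lemma measurable_to_info J : measurable_fun [set: Omega] (id : Omega -> info J).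
Proof.
by move=> _ B mB; rewrite setTI; exact: (generated_by_sub_measurable (Z := Z) mB).
Qed.

Lemma measurable_info_sub J K : J \subset K ->
  measurable_fun [set: info K] (id : info K -> info J).
Proof.
by move=> JK _ B mB; rewrite setTI; exact: (generated_byS (Z := Z) JK mB).
Qed.

Definition to_info J : {mfun Omega >-> info J} :=
  mfun_Sub (mem_set (@measurable_to_info J)).

Lemma measurable_info_pair J K :
  measurable_fun [set: info (J :|: K)%SET]
    ((fun w => (w, w)) : info (J :|: K)%SET -> (info J * info K)%type).
Proof.
by apply: measurable_fun_pair; apply: measurable_info_sub;
  [exact: finset.subsetUl|exact: finset.subsetUr].
Qed.

(** The diagonal (w, w) replaces both copies of the sample point of D by the actual
one. *)
Lemma info_freezing J K (E : set Omega) (D : set (info J * info K)) (p : R) :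
    independent_subfamilies Z J K ->
    generated_by Z J E -> measurable D -> 0 <= p ->
    (forall x : Omega, (Pr [set w | D (x, w)] <= p%:E)%E) ->
  (Pr (E `&` [set w | D (w, w)]) <= p%:E * Pr E)%E.
Proof.
move=> JK JE mD p0 Dp.
by apply: (@freezing _ _ _ _ _ _ _ Pr (to_info J) (to_info K) _ E D p).
Qed.

End subfamily_information.

Section trained_predictors.
Context d (X : measurableType d) (R : realType) (P : probability (X * R)%type R).
Variable fstar : X -> R.
Hypothesis mfstar : measurable_fun setT fstar.
Context dS (S : measurableType dS).
Implicit Types h : S -> X -> R.

Definition jointly_measurable h := measurable_fun setT (fun p : S * X => h p.1 p.2).

(** Tonelli: an integral over the evaluation point is measurable in the training
data. *)
Lemma measurable_regret h : jointly_measurable h ->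
  measurable_fun setT (fun s => regret P fstar (h s)).
Proof.
move=> mh; rewrite /regret unlock.
apply: measurableT_comp => //.
apply: (measurable_fun_fubini_tonelli_F (m2 := P)
  (fun p : S * (X * R) => ((h p.1 p.2.1 - fstar p.2.1) ^+ 2)%:E)).
  apply/measurable_EFinP; apply: measurable_funX; apply: measurable_funB.
    apply: (measurableT_comp mh (g := fun p : S * (X * R) => (p.1, p.2.1))).
    apply: measurable_fun_pair => //.
    exact: measurableT_comp.
  apply: (measurableT_comp mfstar (g := fun p : S * (X * R) => p.2.1)).
  exact: measurableT_comp.
by move=> p; rewrite lee_fin sqr_ge0.
Qed.

Context dT (T : measurableType dT).

Lemma measurable_loss_diff h h' (z : T -> X * R) :
    jointly_measurable h -> jointly_measurable h' -> measurable_fun setT z ->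
  measurable_fun setT
    (fun p : S * T => loss_diff (h p.1) (h' p.1) (z p.2)).
Proof.
move=> mh mh' mz.
have mz2 : measurable_fun setT (fun p : S * T => z p.2).
  exact: measurableT_comp mz measurable_snd.
have key g : jointly_measurable g ->
    measurable_fun setT (fun p : S * T => gamma (g p.1) (z p.2)).
  move=> mg; apply: measurable_funX; apply: measurable_funB.
    exact: measurableT_comp measurable_snd mz2.
  apply: (measurableT_comp mg (g := fun p : S * T => (p.1, (z p.2).1))).
  apply: measurable_fun_pair => //.
  exact: measurableT_comp measurable_fst mz2.
by apply: measurable_funB; exact: key.
Qed.

Variables (N : nat) (Z : 'I_N -> T -> X * R) (K : {set 'I_N}).
Hypothesis mZ : forall i, i \in K -> measurable_fun setT (Z i).

(** The training data s and the test data t are kept as separate coordinates, so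
that the former can be frozen. *)
Definition deviation h h' (a b : R) : set (S * T) := [set p |
  a * (regret P fstar (h p.1) + regret P fstar (h' p.1)) + b <=
  `|empirical (fun i => Z i p.2) K (loss_diff (h p.1) (h' p.1))
    - (regret P fstar (h p.1) - regret P fstar (h' p.1))| ].

Lemma measurable_deviation h h' a b :
    jointly_measurable h -> jointly_measurable h' ->
  measurable (deviation h h' a b).
Proof.
move=> mh mh'.
have mr g : jointly_measurable g ->
    measurable_fun setT (fun p : S * T => regret P fstar (g p.1)).
  by move=> mg; exact: measurableT_comp (measurable_regret mg) measurable_fst.
pose u (p : S * T) := a * (regret P fstar (h p.1) + regret P fstar (h' p.1)) + b.
pose v (p : S * T) := `|empirical (fun i => Z i p.2) K (loss_diff (h p.1) (h' p.1))
    - (regret P fstar (h p.1) - regret P fstar (h' p.1))|.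
suff : measurable_fun setT (fun p => u p <= v p).
  move=> /(_ measurableT [set true]); rewrite setTI.
  by apply.
apply: measurable_fun_ler.
- apply: measurable_funD => //; apply: measurable_funM => //.
  by apply: measurable_funD; exact: mr.
- apply: measurableT_comp => //; apply: measurable_funB; last first.
    by apply: measurable_funB; exact: mr.
  apply: measurable_funM => //; rewrite /empirical.
  under eq_fun do rewrite big_mkcond/=.
  apply: measurable_sum => i; have [iK|iK] := boolP (i \in K); last by [].
  by apply: measurable_loss_diff => //; exact: mZ.
Qed.

End trained_predictors.

(** * The error of one test fold *)

Section constants.
Context (R : realType).

(** Bounding exp(1/15) by 1 / (1 - 1/15) is sharp enough: (15/14)^10 < 2. *)
Lemma expR_two_thirds : expR (2 / 3 : R) <= 2.
Proof.
have h : expR (15^-1 : R) <= 15 / 14.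
  have e1 := expR_ge1Dx (- 15^-1 : R).
  have e2 := expRxMexpNx_1 (15^-1 : R).
  have e0 := expR_gt0 (15^-1 : R).
  rewrite -(ler_pM2r (expR_gt0 (- 15^-1))) e2; lra.
have -> : 2 / 3 = 10%:R * 15^-1 :> R by field.
rewrite expRM_natl.
apply: le_trans (_ : (15 / 14) ^+ 10 <= _).
  by rewrite lerXn2r// nnegrE ?expR_ge0// divr_ge0.
by rewrite !exprS expr0; lra.
Qed.

(** Write a = a1 + a2, with a1 the part in chi and a2 the part in eps, so that the
squared threshold (a L + b)^2 is at least (a1 L)^2 + (a2 L + b)^2, and the second
square is at least 4 a2 b L. After multiplication by N / (4 V) these two terms
are 32 chi^4 L^2 and 128 sqrt(2) sigma^2 L, while 12 S is at most
30 chi^4 L^2 + 160 sigma^2 L. *)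
Lemma deviation_budget (N V n : nat) (chi sigma eps L S : R) :
  (0 < N)%N -> (0 < V)%N -> 0 < chi -> 0 < sigma -> 0 < eps -> 0 <= L ->
  N%:R / (4 * V%:R) <= n%:R :> R ->
  S <= 5 / 2 * chi ^+ 4 * L ^+ 2 + 40 / 3 * sigma ^+ 2 * L ->
  S / (n%:R * (a_const chi eps N V * L + b_const sigma eps N V) ^+ 2) <= 12^-1.
Proof.
move=> N0 V0 chi0 sig0 eps0 L0 nNV SL.
have rN : 0 < N%:R :> R by rewrite ltr0n.
have rV : 0 < V%:R :> R by rewrite ltr0n.
set t := a_const chi eps N V * L + b_const sigma eps N V.
pose q : R := Num.sqrt (2 * V%:R / N%:R).
have q0 : 0 <= q by rewrite sqrtr_ge0.
have qq : q ^+ 2 = 2 * V%:R / N%:R by rewrite sqr_sqrtr// divr_ge0// mulr_ge0// ltW.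
pose r : R := Num.sqrt 2.
have r0 : 0 <= r by rewrite sqrtr_ge0.
have rr : r ^+ 2 = 2 by rewrite sqr_sqrtr.
(* 128 * 5/4 = 160 *)
have r54 : 5 / 4 <= r by nra.
pose b := b_const sigma eps N V.
have b0 : 0 < b by rewrite divr_gt0 ?mulr_gt0 ?exprn_gt0.
pose a1 := 8 * chi ^+ 2 * q; pose a2 := 2 * r * eps.
have tE : t = a1 * L + (a2 * L + b) by rewrite /t /a_const -/q -/r -/b /a1 /a2; ring.
have a10 : 0 <= a1 by apply: mulr_ge0 => //; apply: mulr_ge0 => //; exact: sqr_ge0.
have a20 : 0 <= a2 by apply: mulr_ge0; [exact: mulr_ge0|exact: ltW].
have t2 : (a1 * L) ^+ 2 + 4 * (a2 * b * L) <= t ^+ 2.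
  have := mulr_ge0 a10 L0; have := mulr_ge0 a20 L0; rewrite tE.
  have := sqr_ge0 (a2 * L - b); nra.
have t0 : 0 < t.
  by rewrite tE; have := mulr_ge0 a10 L0; have := mulr_ge0 a20 L0; lra.
have n0 : 0 < n%:R :> R by apply: lt_le_trans nNV; rewrite divr_gt0// mulr_gt0.
rewrite ler_pdivrMr ?mulr_gt0 ?exprn_gt0//.
have step : N%:R / (4 * V%:R) * ((a1 * L) ^+ 2 + 4 * (a2 * b * L)) <= n%:R * t ^+ 2.
  have k0 : 0 < N%:R / (4 * V%:R) :> R by apply: divr_gt0 => //; exact: mulr_gt0.
  have ab0 : 0 <= a2 * b * L by exact: mulr_ge0 (mulr_ge0 a20 (ltW b0)) L0.
  apply: ler_pM => //.
  by have := sqr_ge0 (a1 * L); lra.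
have E : N%:R / (4 * V%:R) * ((a1 * L) ^+ 2 + 4 * (a2 * b * L)) =
    32 * (chi ^+ 4 * L ^+ 2) + 128 * (r * (sigma ^+ 2 * L)).
  rewrite /a1 /a2 /b /b_const !exprMn qq; field.
  by rewrite !gt_eqF.
have c0 : 0 <= chi ^+ 4 * L ^+ 2 by rewrite mulr_ge0 ?exprn_ge0// ltW.
have s0 : 0 <= sigma ^+ 2 * L by rewrite mulr_ge0 ?sqr_ge0.
have rs := ler_wpM2r s0 r54.
rewrite E in step; rewrite -2!mulrA in SL.
rewrite -(mulrA (40 / 3)) in SL.
set A := chi ^+ 4 * L ^+ 2 in c0 step SL.
set B := sigma ^+ 2 * L in s0 rs step SL.
lra.
Qed.

End constants.

(** * Many simultaneous errors are unlikely *)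

Lemma sum_subsets_expr (R : comNzRingType) (J : finType) (C : {set J}) (p : R) :
  \sum_(s : {set J} | s \subset C) p ^+ #|s| = (1 + p) ^+ #|C|.
Proof.
rewrite exprDn (partition_big (fun s : {set J} => inord #|s| : 'I_#|C|.+1) xpredT)//=.
apply: eq_bigr => i _; rewrite expr1n mul1r.
rewrite (eq_bigr (fun=> p ^+ i)); last first.
  move=> s /andP[sC /eqP <-]; rewrite inordK// ltnS subset_leq_card//.
rewrite -(cards_draws C i) sumr_const; congr (_ *+ _).
apply: eq_card => s; rewrite !inE; apply/andP/andP => -[sC /eqP si]; split => //.
  by rewrite -si inordK// ltnS subset_leq_card.
by apply/eqP/val_inj; rewrite /= si inordK.
Qed.

Section tail_of_counts.
Context d (Omega : measurableType d) (R : realType) (Pr : probability Omega R).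
Variables (J : finType) (C : {set J}) (A : J -> set Omega).
Hypothesis mA : forall v, measurable (A v).
Local Open Scope ereal_scope.

Definition occurring (w : Omega) : {set J} := [set v in C | `[< A v w >]]%SET.

Let cap (s : {set J}) := \bigcap_(v in [set` s]) A v.

Let mcap s : measurable (cap s).
Proof. by apply: fin_bigcap_measurable => // v _; exact: mA. Qed.

Let capP (s : {set J}) w : s \subset C -> (w \in cap s) = (s \subset occurring w).
Proof.
move=> /fintype.subsetP sC; apply/idP/fintype.subsetP => [|h].
  by rewrite inE => h v vs; rewrite inE sC//=; apply/asboolP/h.
by rewrite inE => v /= /h; rewrite inE => /andP[_ /asboolP].
Qed.

Lemma measurable_many_occurring n :
  measurable [set w | (n <= 6 * #|occurring w|)%N].
Proof.
rewrite [X in measurable X](_ : _ =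
   \bigcup_(s in [set s : {set J} | s \subset C /\ (n <= 6 * #|s|)%N]) cap s).
  by apply: fin_bigcup_measurable => // s _; exact: mcap.
apply/seteqP; split => [w nw|w [s [sC ns] sw]] /=.
  exists (occurring w); last first.
    by move=> v /=; rewrite inE => /andP[_ /asboolP].
  by split => //; apply/fintype.subsetP => v; rewrite inE => /andP[].
apply: leq_trans ns _; rewrite leq_mul2l/= subset_leq_card//.
by rewrite -capP// inE.
Qed.

(** Chernoff bound. If k of the events occur then 2^k subsets of them occur
jointly, so the expectation of 2^k is the sum over subsets s of the probability
that s occurs, at most (1 + 1/12)^n <= exp(n/12). On the event k >= n/6 this
variable is at least exp(2/3)^k >= exp(n/9). *)
Lemma many_occurring_rare n : (#|C| <= n)%N ->
    (forall s : {set J}, s \subset C -> Pr (cap s) <= (12^-1 ^+ #|s|)%:E) ->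
  Pr [set w | (n <= 6 * #|occurring w|)%N] <= (expR (- (n%:R / 36)))%:E.
Proof.
move=> Cn hp; set B := [set w | _].
have mB : measurable B := measurable_many_occurring n.
suff h : (expR (n%:R / 9))%:E * Pr B <= (expR (n%:R / 12))%:E.
  have [r Er] : exists r, Pr B = r%:E.
    by exists (fine (Pr B)); rewrite fineK// fin_num_measure.
  move: h; rewrite Er -EFinM !lee_fin.
  rewrite mulrC -ler_pdivlMr ?expR_gt0// -expRN -expRD => /le_trans; apply.
  by rewrite ler_expR; lra.
have -> : (expR (n%:R / 9))%:E * Pr B =
    \int[Pr]_w ((expR (n%:R / 9))%:E * (\1_B w)%:E).
  rewrite ge0_integralZl_EFin ?expR_ge0//; first by rewrite integral_indic// setIT.
  by apply/measurable_EFinP; exact: measurable_indic.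
have m1 s : measurable_fun setT (fun w => (\1_(cap s) w)%:E : \bar R).
  by apply/measurable_EFinP; apply: measurable_indic; exact: mcap.
apply: (@le_trans _ _ (\int[Pr]_w \sum_(s : {set J} | s \subset C) (\1_(cap s) w)%:E)).
  apply: ge0_le_integral => //.
  - by apply: measurable_funeM; apply/measurable_EFinP; exact: measurable_indic.
  - by under eq_fun do rewrite -big_filter; exact: emeasurable_sum.
  move=> w _.
  have -> : \sum_(s : {set J} | s \subset C) (\1_(cap s) w)%:E =
      (2 ^+ #|occurring w|)%:E :> \bar R.
    rewrite sumEFin; congr EFin.
    rewrite -natrX -card_powerset -sum1_card natr_sum big_mkcond [RHS]big_mkcond/=.
    apply: eq_bigr => s _; rewrite indicE powersetE.
    case: ifPn => sC; first by rewrite capP//; case: ifP.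
    case: ifPn => // /fintype.subset_trans so; case/negP: sC; apply: so.
    by apply/fintype.subsetP => v; rewrite inE => /andP[].
  rewrite indicE; have [wB|_] := boolP (w \in B); last by rewrite mule0 lee_fin exprn_ge0.
  rewrite mule1 lee_fin.
  apply: (@le_trans _ _ (expR (2 / 3) ^+ #|occurring w|)%R); last first.
    by rewrite lerXn2r ?nnegrE ?expR_ge0 ?expR_two_thirds.
  rewrite -expRM_natl ler_expR; move: wB; rewrite inE /B /= => wB.
  have : (n%:R <= 6 * #|occurring w|%:R :> R)%R by rewrite -natrM ler_nat.
  lra.
under eq_integral do rewrite -big_filter.
rewrite ge0_integral_sum// big_filter.
under eq_bigr => s sC do rewrite integral_indic ?setIT//.
apply: le_trans (lee_sum _ hp) _.
rewrite sumEFin lee_fin sum_subsets_expr.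
apply: (@le_trans _ _ ((1 + 12^-1) ^+ n)%R).
  by rewrite ler_weXn2l// lerDl invr_ge0.
apply: (@le_trans _ _ (expR (12^-1) ^+ n)%R).
  by rewrite lerXn2r ?nnegrE ?expR_ge0 ?expR_ge1Dx.
by rewrite -expRM_natl.
Qed.

End tail_of_counts.

(** Choosing a point of O in each part that meets O is injective, because the parts
are disjoint. *)
Lemma card_meeting_le (I V : finType) (T : V -> {set I}) (O : {set I}) :
    (forall u v, u != v -> [disjoint T u & T v]%B) ->
  (#|~: [set v | T v \subset ~: O]| <= #|O|)%N.
Proof.
move=> T_disj; pose hit v := [pick i in T v :&: O]%SET.
have hitP v : v \in (~: [set v | T v \subset ~: O])%SET ->
    exists2 i, i \in (T v :&: O)%SET & hit v = Some i.
  rewrite !inE finset.subsets_disjoint finset.setCK -setI_eq0 => /set0Pn[j jTO].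
  by rewrite /hit; case: pickP => [i iTO|/(_ j)]; [exists i|rewrite jTO].
rewrite -(card_in_imset (f := hit)); last first.
  move=> u v /hitP[i iu ->] /hitP[j jv ->] [ij]; subst j.
  apply/eqP; apply: contraTT iu => /T_disj uv.
  move: jv; rewrite !inE => /andP[iv iO]; rewrite iO andbT.
  by rewrite (disjointFl uv).
have Sinj : injective (@Some I) by move=> ? ? [].
rewrite -(card_imset _ Sinj); apply: subset_leq_card.
apply/fintype.subsetP => _ /imsetP[v /hitP[i iTO ->] ->].
by apply: imset_f; move: iTO; rewrite inE => /andP[].
Qed.

Section median.
Context (R : realType) (V : nat).

(** At least half of the values lie on each side of a median, and fewer than half
of them are bad, so each side contains a value close to c. *)
Lemma median_robust (x : 'I_V -> R) (t c delta : R) (bad : {set 'I_V}) :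
    (2 * #|bad| < V)%N -> (forall v, v \notin bad -> `|x v - c| <= delta) ->
  is_median x t -> `|t - c| <= delta.
Proof.
move=> badV good [Vle Vge].
have pick (q : pred 'I_V) : (V <= 2 * #|q|)%N -> exists2 v, q v & `|x v - c| <= delta.
  move=> Vq; have /existsP[v /andP[qv vbad]] : [exists v, q v && (v \notin bad)].
    apply: contraTT Vq => /existsPn h; rewrite -ltnNge.
    apply: leq_ltn_trans badV; rewrite leq_mul2l/= subset_leq_card//.
    by apply/fintype.subsetP => v; rewrite unfold_in => qv; have := h v; rewrite qv negbK.
  by exists v => //; exact: good.
have [v /= xv] := pick _ Vle; have [u /= xu] := pick _ Vge.
rewrite !ler_norml => /andP[_ h1] /andP[h2 _].
by apply/andP; split; lra.
Qed.

End median.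

(** * Accuracy of the test between two trained predictors *)

Section fold_events.
Context (d d' : measure_display) (X : measurableType d) (R : realType).
Variable P : probability (X * R)%type R.
Hypothesis P_Y2 : ('E_P[(fun z : X * R => (z.2 ^+ 2)%R)] < +oo)%E.
Variable F : {pred X -> R}.
Hypothesis F_L2 : {subset F <= Lfun (marginalX P) 2%:E}.
Hypothesis F_lin : submod_closed F.
Variable fstar : X -> R.
Hypothesis fstar_oracle : is_oracle P F fstar.
Variables chi sigma eps : R.
Hypotheses (chi_gt0 : 0 < chi) (sigma_gt0 : 0 < sigma) (eps_gt0 : 0 < eps).
Hypothesis F_chi : forall f, f \in F ->
     (poweR 'E_P[(fun z : X * R => (f z.1 ^+ 4)%R)] (4^-1)
      <= chi%:E * poweR 'E_P[(fun z : X * R => (f z.1 ^+ 2)%R)] (2^-1))%E.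
Hypothesis F_sigma : forall f, f \in F ->
     ('E_P[(fun z : X * R => ((z.2 - fstar z.1) ^+ 2 * (f z.1 - fstar z.1) ^+ 2)%R)]
      <= (sigma ^+ 2)%:E * 'E_P[(fun z : X * R => ((f z.1 - fstar z.1) ^+ 2)%R)])%E.
Variables (Omega : measurableType d') (Pr : probability Omega R) (N : nat).
Variables (Z : 'I_N -> {RV Pr >-> (X * R)%type}) (O : {set 'I_N}).
Hypotheses (N_gt0 : (0 < N)%N) (Z_iid : iid_on Z (~: O)%SET P).
Hypothesis Z_indep : independent_subfamilies Z O (~: O)%SET.
Variable V : nat.
Hypothesis V_gt0 : (0 < V)%N.
Variable J : {set 'I_N}.
Variables h h' : Omega -> X -> R.
Hypotheses (hF : forall w, h w \in F) (h'F : forall w, h' w \in F).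
Hypothesis mh : jointly_measurable (h : info Z J -> X -> R).
Hypothesis mh' : jointly_measurable (h' : info Z J -> X -> R).

Let a := a_const chi eps N V.
Let b := b_const sigma eps N V.

Definition fold_deviation (K : {set 'I_N}) : set (info Z J * info Z K) :=
  deviation P fstar (fun i (w : info Z K) => Z i w) K h h' a b.

Arguments fold_deviation K : clear implicits.

Definition fold_event (K : {set 'I_N}) : set Omega :=
  [set w | fold_deviation K (w, w)].

Lemma measurable_fold_deviation K : measurable (fold_deviation K).
Proof.
apply: measurable_deviation => //.
  exact: (F_measurable F_L2 fstar_oracle.1).
by move=> i iK; exact: measurable_info.
Qed.

Lemma fold_event_generated K : generated_by Z (J :|: K)%SET (fold_event K).
Proof.
have := measurable_info_pair (Z := Z) (J := J) (K := K).
move=> /(_ measurableT _ (@measurable_fold_deviation K)).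
by rewrite setTI.
Qed.

(** With the training data frozen at w the predictors are deterministic, and
Chebyshev's inequality applies to the test data w'. *)
Lemma fold_deviation_rare (K : {set 'I_N}) (w : Omega) : K \subset (~: O)%SET ->
    N%:R / (4 * V%:R) <= #|K|%:R :> R ->
  (Pr [set w' | fold_deviation K (w, w')] <= (12^-1)%:E)%E.
Proof.
move=> KO NK.
have [l2 lE lS] := loss_diff_moments P_Y2 F_L2 F_lin fstar_oracle
  chi_gt0 F_chi F_sigma (hF w) (h'F w).
set L := regret P fstar (h w) + regret P fstar (h' w).
have L0 : 0 <= L by rewrite addr_ge0 ?regret_ge0.
have rN : 0 < N%:R :> R by rewrite ltr0n.
have rV : 0 < V%:R :> R by rewrite ltr0n.
have K0 : (0 < #|K|)%N.
  rewrite -(ltr_nat R); apply: lt_le_trans NK; apply: divr_gt0 => //.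
  exact: mulr_gt0.
have b0 : 0 < b by rewrite divr_gt0 ?mulr_gt0 ?exprn_gt0.
have a0 : 0 <= a.
  by rewrite addr_ge0 ?mulr_ge0 ?sqrtr_ge0 ?sqr_ge0// ltW.
have t0 : 0 < a * L + b by rewrite ltr_wpDl// mulr_ge0.
have := empirical_mean_deviation Z_iid KO K0 t0 l2.
rewrite lE => /le_trans; apply; rewrite lee_fin.
exact: deviation_budget.
Qed.

(** The set J0 contains the training data and the folds examined earlier. *)
Lemma fold_event_step (J0 K : {set 'I_N}) (E : set Omega) : J \subset J0 ->
    K \subset (~: O)%SET -> [disjoint J0 & K]%B ->
    N%:R / (4 * V%:R) <= #|K|%:R :> R -> generated_by Z J0 E ->
  (Pr (E `&` fold_event K) <= (12^-1)%:E * Pr E)%E.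
Proof.
move=> JJ0 KO J0K NK J0E.
pose D : set (info Z J0 * info Z K) := [set p | fold_deviation K (p.1, p.2)].
have mD : measurable D.
  have : measurable_fun [set: info Z J0 * info Z K]
      (fun p => (p.1, p.2) : info Z J * info Z K).
    apply: measurable_fun_pair => //.
    exact: measurableT_comp (measurable_info_sub (Z := Z) JJ0) measurable_fst.
  by move=> /(_ measurableT _ (@measurable_fold_deviation K)); rewrite setTI.
apply: (@info_freezing _ _ _ _ _ _ _ _ J0 K E D) => //.
  exact: (disjoint_independent Z_iid.1).
by move=> w; exact: fold_deviation_rare.
Qed.

Variable T : 'I_V -> {set 'I_N}.
Hypothesis T_disj : forall u v, u != v -> [disjoint T u & T v]%B.
Hypothesis T_test : forall v, [disjoint J & T v]%B.
Hypothesis T_large : forall v, N%:R / (4 * V%:R) <= #|T v|%:R :> R.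

Definition clean_folds : {set 'I_V} := [set v | T v \subset (~: O)%SET]%SET.

Lemma clean_folds_deviate (s : {set 'I_V}) : s \subset clean_folds ->
  (Pr (\bigcap_(v in [set` s]) fold_event (T v)) <= (12^-1 ^+ #|s|)%:E)%E.
Proof.
move=> /fintype.subsetP sC.
have clean v : v \in s -> T v \subset (~: O)%SET by move=> /sC; rewrite inE.
apply: (adaptive_product_bound (Z := Z) (J := J) (B := T)) => //.
- by move=> u v _ _; exact: T_disj.
- by move=> v _; exact: fold_event_generated.
- move=> v J0 E vs JJ0 disj J0E.
  exact: (fold_event_step JJ0 (clean v vs) disj (T_large v) J0E).
Qed.

(** Folds that contain an outlier are counted apart, by [card_meeting_le]. *)
Definition misled_folds (w : Omega) : {set 'I_V} :=
  occurring clean_folds (fun v => fold_event (T v)) w.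

Lemma many_misled_folds :
  measurable [set w | (V <= 6 * #|misled_folds w|)%N] /\
  (Pr [set w | (V <= 6 * #|misled_folds w|)%N] <= (expR (- (V%:R / 36)))%:E)%E.
Proof.
have mA v : measurable (fold_event (T v)).
  exact: (generated_by_sub_measurable (@fold_event_generated (T v))).
split; first exact: measurable_many_occurring.
apply: many_occurring_rare => //.
  by rewrite -[leqRHS]card_ord max_card.
exact: clean_folds_deviate.
Qed.

(** At most V/3 folds meet the outliers and fewer than V/6 others are wrong, which
leaves a majority of accurate folds. *)
Lemma few_misled_folds w t : (3 * #|O| <= V)%N ->
    ~ (V <= 6 * #|misled_folds w|)%N ->
    is_median (fun v => empirical (fun i => Z i w) (T v) (loss_diff (h w) (h' w))) t ->
  `|t - (regret P fstar (h w) - regret P fstar (h' w))| <=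
    a * (regret P fstar (h w) + regret P fstar (h' w)) + b.
Proof.
move=> OV /negP; rewrite -ltnNge => misled.
apply: (median_robust (bad := (~: clean_folds :|: misled_folds w)%SET)).
  have unclean : (#|~: clean_folds| <= #|O|)%N := card_meeting_le O T_disj.
  move: (cardsU (~: clean_folds)%SET (misled_folds w)) unclean misled OV; clear; lia.
move=> v; rewrite !inE negb_or negbK => /andP[vC].
rewrite vC/= => /asboolPn; rewrite /fold_event/= /fold_deviation /deviation/=.
by move=> /negP; rewrite -ltNge => /ltW.
Qed.

End fold_events.

(** * Training on a block *)

Section estimators.
Context (d d' : measure_display) (X : measurableType d) (R : realType).
Variables (Omega : measurableType d') (Pr : probability Omega R) (N : nat).
Variables (Z : 'I_N -> {RV Pr >-> (X * R)%type}).
Variables (F : {pred X -> R}) (Lambda : finType).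
Variable G : Lambda -> forall n, n.-tuple (X * R)%type -> X -> R.
Hypothesis G_alg : forall l, learning_algorithm F (G l).

Definition fitted (m : Lambda * {set 'I_N}) (w : Omega) : X -> R :=
  estimator G (fun i => Z i w) m.

Lemma fitted_in_F (m : Lambda * {set 'I_N}) w : (0 < #|m.2|)%N -> fitted m w \in F.
Proof. by move=> m0; have [GF _] := G_alg m.1 m0; exact: GF. Qed.

Lemma measurable_subsample (J B : {set 'I_N}) : B \subset J ->
  measurable_fun [set: info Z J] (fun w => subsample (fun i => Z i w) B).
Proof.
move=> /fintype.subsetP BJ; apply/measurable_fun_tnthP => i /=.
have iB : tnth (enum_tuple (mem B)) i \in J.
  by apply: BJ; rewrite -mem_enum; exact: mem_tnth.
have -> : (@tnth #|B| (X * R)%type ^~ i) \o (fun w => subsample (fun i => Z i w) B) =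
    Z (tnth (enum_tuple (mem B)) i).
  by apply/funext => w /=; rewrite tnth_map.
exact: measurable_info.
Qed.

Lemma measurable_fitted (J : {set 'I_N}) (m : Lambda * {set 'I_N}) :
    (0 < #|m.2|)%N -> m.2 \subset J ->
  jointly_measurable (fitted m : info Z J -> X -> R).
Proof.
move=> m0 mJ; have [_ mG] := G_alg m.1 m0.
apply: (measurableT_comp mG
  (g := fun p : info Z J * X => (subsample (fun i => Z i p.1) m.2, p.2))).
apply: measurable_fun_pair => //.
exact: measurableT_comp (measurable_subsample mJ) measurable_fst.
Qed.

End estimators.

Section training_blocks.
Context (d d' : measure_display) (X : measurableType d) (R : realType).
Variable P : probability (X * R)%type R.
Hypothesis P_Y2 : ('E_P[(fun z : X * R => (z.2 ^+ 2)%R)] < +oo)%E.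
Variable F : {pred X -> R}.
Hypothesis F_L2 : {subset F <= Lfun (marginalX P) 2%:E}.
Hypothesis F_lin : submod_closed F.
Variable fstar : X -> R.
Hypothesis fstar_oracle : is_oracle P F fstar.
Variables (Omega : measurableType d') (Pr : probability Omega R) (N : nat).
Variables (Z : 'I_N -> {RV Pr >-> (X * R)%type}) (O : {set 'I_N}).
Hypotheses (Z_iid : iid_on Z (~: O)%SET P).
Hypothesis Z_indep : independent_subfamilies Z O (~: O)%SET.
Variable Lambda : finType.
Variable G : Lambda -> forall n, n.-tuple (X * R)%type -> X -> R.
Hypothesis G_alg : forall l, learning_algorithm F (G l).

Definition poorly_trained (m : Lambda * {set 'I_N}) (r : \bar R) : set Omega :=
  [set w | (r < (regret P fstar (fitted Z G m w))%:E)%E].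

(** The assumption on the rates provides an event of the whole sample
space. Independence between blocks requires an event of the data of the block,
and joint measurability of the algorithm shows that failure is one. *)
Lemma poorly_trained_generated (m : Lambda * {set 'I_N}) r : (0 < #|m.2|)%N ->
  generated_by Z m.2 (poorly_trained m r).
Proof.
move=> m0; have mstar := F_measurable F_L2 fstar_oracle.1.
have mreg := measurable_regret P mstar
  (measurable_fitted (Z := Z) G_alg m0 (subxx _)).
have /measurable_EFinP mregE := mreg.
have := emeasurable_fun_o_infty measurableT mregE r.
by rewrite setTI.
Qed.

Lemma poorly_trained_rare (m : Lambda * {set 'I_N}) r : (0 < #|m.2|)%N ->
    probability_at_least Pr (1 - expR (- (1 / 48)))
      [set w | (excess_risk P fstar (estimator G (fun i => Z i w) m) <= r)%E] ->
  (Pr (poorly_trained m r) <= (expR (- (1 / 48)))%:E)%E.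
Proof.
move=> m0 [A [mA Asub PrA]].
have mpt := generated_by_sub_measurable (poorly_trained_generated r m0).
have sub : poorly_trained m r `<=` ~` A.
  move=> w /= lt /Asub /=.
  rewrite (excess_riskE P_Y2 F_L2 F_lin fstar_oracle); last exact: (fitted_in_F Z G_alg w m0).
  by rewrite leNgt lt.
apply: (@le_trans _ _ (Pr (~` A))).
  by apply: le_measure; rewrite ?inE//; exact: measurableC.
rewrite probability_setC// leeBlDr ?fin_num_measure//.
by rewrite -leeBlDl//= EFinB in PrA *.
Qed.

(** Here the events have no common part of the data, and each has probability at
most exp(-1/48) given the other blocks. *)
Lemma some_block_well_trained (K : finType) (B : K -> {set 'I_N}) (l : Lambda)
    (r : K -> \bar R) (C : {set K}) :
    (forall k k', k != k' -> [disjoint B k & B k']%B) ->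
    (forall k, k \in C -> B k \subset (~: O)%SET /\ (0 < #|B k|)%N) ->
    (forall k, k \in C -> probability_at_least Pr (1 - expR (- (1 / 48)))
      [set w | (excess_risk P fstar (estimator G (fun i => Z i w) (l, B k)) <= r k)%E]) ->
  measurable (\bigcap_(k in [set` C]) poorly_trained (l, B k) (r k)) /\
  (Pr (\bigcap_(k in [set` C]) poorly_trained (l, B k) (r k))
     <= (expR (- (#|C|%:R / 48)))%:E)%E.
Proof.
move=> B_disj C_clean C_rate.
have gen k : k \in C -> generated_by Z (B k) (poorly_trained (l, B k) (r k)).
  by move=> /C_clean[_ B0]; exact: (@poorly_trained_generated (l, B k) (r k) B0).
split.
  apply: fin_bigcap_measurable => // k /= kC.
  exact: generated_by_sub_measurable (gen k kC).
have -> : expR (- (#|C|%:R / 48)) = expR (- (1 / 48)) ^+ #|C| :> R.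
  by rewrite -expRM_natl; congr expR; field.
apply: (adaptive_product_bound (Z := Z) (J := finset.set0) (B := B)).
- exact: expR_ge0.
- by move=> u v _ _; exact: B_disj.
- by move=> k _; rewrite finset.disjoints_subset finset.sub0set.
- by move=> k kC; rewrite finset.set0U; exact: gen.
- move=> k J0 E kC _ disj J0E.
  rewrite (disjoint_independent Z_iid.1 Z_indep (C_clean k kC).1 disj J0E (gen k kC)).
  rewrite muleC lee_wpmul2r//.
  exact: (@poorly_trained_rare (l, B k) (r k) (C_clean k kC).2 (C_rate k kC)).
Qed.

End training_blocks.

(** * Selection of the winner *)

(** The winner is compared with a minimizer mo of l over the candidates; for
1 <= a the left-hand side is nonpositive. *)
Lemma minimax_selection (R : realType) (M : finType) (C : {set M})
    (T : M -> M -> R) (l : M -> R) (a b : R) (mhat m0 : M) :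
    0 <= a -> 0 <= b -> (forall m, 0 <= l m) ->
    (forall m m', m \in C -> m' \in C ->
       `|T m m' - (l m - l m')| <= a * (l m + l m') + b) ->
    is_minimax C T mhat -> m0 \in C ->
  (1 - a) * l mhat <= (1 + 3 * a) * l m0 + 2 * b.
Proof.
move=> a0 b0 l0 Tl [mhatC mhat_min] m0C.
have [a1|a1] := leP 1 a.
  apply: (@le_trans _ _ 0); first by rewrite mulr_le0_ge0// subr_le0.
  by rewrite addr_ge0// mulr_ge0// addr_ge0// mulr_ge0.
have [mo moC mo_min] : exists2 m, m \in C & forall m', m' \in C -> l m <= l m'.
  by have [m mC mmin] := arg_minP l m0C; exists m.
have lo := mo_min _ m0C.
suff : (1 - a) * l mhat <= (1 + 3 * a) * l mo + 2 * b.
  move=> /le_trans; apply; rewrite lerD2r ler_wpM2l//.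
  by rewrite addr_ge0// mulr_ge0.
have Tmo : ((T mhat mo)%:E <= (2 * a * l mo + b)%:E)%E.
  apply: le_trans (le_bigmax_cond _ (fun m' => (T mhat m')%:E) moC) _.
  apply: le_trans (mhat_min _ moC) _.
  apply: bigmax_le => [|m' m'C]; first exact: leNye.
  have := Tl _ _ moC m'C; rewrite lee_fin ler_norml => /andP[_ h].
  have : 0 <= (1 - a) * (l m' - l mo) by rewrite mulr_ge0// subr_ge0 ?mo_min// ltW.
  lra.
rewrite lee_fin in Tmo.
have := Tl _ _ mhatC moC; rewrite ler_norml => /andP[h _]; lra.
Qed.

Lemma card_bigcup_le (I : Type) (T : finType) (r : seq I) (A : I -> {set T}) :
  (#|\bigcup_(i <- r) A i| <= \sum_(i <- r) #|A i|)%N.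
Proof.
elim/big_rec2 : _ => [|i s B _ Bs]; first by rewrite cards0.
by apply: leq_trans (leq_card_setU _ _) _; rewrite leq_add2l.
Qed.

Lemma sum_expn2 n : (\sum_(0 <= K < n) 2 ^ K <= 2 ^ n)%N.
Proof.
elim: n => [|n IH]; first by rewrite big_geq.
by rewrite big_nat_recr//= expnS mul2n -addnn leq_add2r.
Qed.

(** * Counting blocks and pairs *)

Section blocks.
Variables (N Kmin Kmax : nat) (Bl : forall K : nat, 'I_(2 ^ K) -> {set 'I_N}).

Arguments Bl : clear implicits.

Lemma all_blocksP (B : {set 'I_N}) : reflect
  (exists K : nat, (Kmin <= K <= Kmax)%N /\ exists k, B = Bl K k)
  (B \in all_blocks Kmin Kmax Bl).
Proof.
have -> : (B \in all_blocks Kmin Kmax Bl) =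
    has (fun K => B \in \bigcup_(k < 2 ^ K) [set Bl K k])%SET (index_iota Kmin Kmax.+1).
  rewrite /all_blocks; elim: (index_iota _ _) => [|K r IH]; first by rewrite big_nil inE.
  by rewrite big_cons finset.in_setU IH.
apply: (iffP hasP) => [[K]|[K [KK [k ->]]]].
  rewrite mem_index_iota ltnS => KK /finset.bigcupP[k _ /finset.set1P ->].
  by exists K; split => //; exists k.
exists K; first by rewrite mem_index_iota ltnS.
by apply/finset.bigcupP; exists k => //; rewrite finset.set11.
Qed.

Lemma card_all_blocks : (Kmax <= trunc_log 2 N)%N -> (0 < N)%N ->
  (#|all_blocks Kmin Kmax Bl| <= 2 * N)%N.
Proof.
move=> KN N0; apply: leq_trans (card_bigcup_le _ _) _.
apply: (@leq_trans (\sum_(Kmin <= K < Kmax.+1) 2 ^ K)%N).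
  apply: leq_sum => K _; apply: leq_trans (card_bigcup_le _ _) _.
  under eq_bigr do rewrite cards1.
  by rewrite sum1_card card_ord.
apply: (@leq_trans (\sum_(0 <= K < Kmax.+1) 2 ^ K)%N).
  have [KK|KK] := leqP Kmin Kmax.+1; last by rewrite big_geq// ltnW.
  by rewrite [leqRHS](big_cat_nat (n := Kmin))//= leq_addl.
apply: leq_trans (sum_expn2 _) _; rewrite expnS leq_mul2l/=.
apply: leq_trans (leq_pexp2l _ KN) _ => //.
by have /andP[] := trunc_log_bounds (isT : 1 < 2)%N N0.
Qed.

(** Take the smallest power of 2 above 2 V, which is below 4 V, unless 2 ^ Kmin is
already large enough. *)
Lemma resolution_level V : (0 < Kmin)%N -> (Kmin <= Kmax)%N ->
    (V <= 2 ^ Kmax.-1)%N -> (0 < V)%N ->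
  exists K, [/\ (Kmin <= K <= Kmax)%N, (2 * V <= 2 ^ K)%N &
     (2 ^ K <= maxn (4 * V) (2 ^ Kmin))%N].
Proof.
move=> Kmin0 KK VK V0.
have [hV|hV] := leqP (2 * V) (2 ^ Kmin).
  by exists Kmin; rewrite leqnn KK hV leq_maxr.
have V1 : (1 < 2 * V)%N by lia.
have /andP[lo hi] := up_log_bounds (isT : 1 < 2)%N V1.
have Kpos : (0 < up_log 2 (2 * V))%N.
  by case: (up_log 2 (2 * V)) hi => //; rewrite expn0; lia.
exists (up_log 2 (2 * V)); split => //.
- apply/andP; split.
    rewrite -(leq_exp2l (m := 2))//; exact: leq_trans (ltnW hV) hi.
  apply: up_log_min => //.
  have -> : Kmax = Kmax.-1.+1 by lia.
  by rewrite expnS leq_mul2l.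
- rewrite leq_max; apply/orP; left.
  by rewrite -(prednK Kpos) expnS; lia.
Qed.

End blocks.

Lemma union_bound d (Omega : measurableType d) (R : realType)
    (Pr : probability Omega R) (I : finType) (C : {set I}) (A : I -> set Omega) (p : R) :
    (forall i, i \in C -> measurable (A i) /\ (Pr (A i) <= p%:E)%E) ->
  measurable (\bigcup_(i in [set` C]) A i) /\
  (Pr (\bigcup_(i in [set` C]) A i) <= (#|C|%:R * p)%:E)%E.
Proof.
move=> Ap.
have -> : \bigcup_(i in [set` C]) A i = \big[setU/set0]_(i <- enum C) A i.
  rewrite -bigcup_seq; apply/seteqP; split=> w [i /= iC Aw]; exists i => //=;
    by move: iC; rewrite mem_enum.
have sub i : i \in enum C -> i \in C by rewrite mem_enum.
rewrite cardE; elim: (enum C) sub => [_|i l IH sub].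
  by rewrite big_nil measure0 mul0r.
have [mi pi] := Ap i (sub i (mem_head _ _)).
have [|ml pl] := IH; first by move=> j jl; apply: sub; rewrite inE jl orbT.
rewrite big_cons; split; first exact: measurableU.
apply: le_trans (measureU2 _ mi ml) _.
by rewrite /= -natr1 mulrDl mul1r addrC EFinD leeD.
Qed.

(** The maximum of nu is rounded up to an integer n, and n m <= N gives n <= N / m
without loss in the integer division. *)
Lemma training_size_large (R : realType) (Lambda : finType)
    (nu : Lambda -> R) (N m : nat) (l : Lambda) :
    0 < nu l -> (0 < m)%N ->
    (Num.ceil (\big[Num.max/0]_l nu l))%:~R * (2 * m)%:R <= N%:R :> R ->
  (0 < N %/ m)%N /\ nu l <= (N %/ m)%:R.
Proof.
move=> nu0 m0 h.
set x := \big[Num.max/0]_l nu l in h.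
have nux : nu l <= x by exact: le_bigmax.
have cx : x <= (Num.ceil x)%:~R by exact: ceil_ge.
have c0 : 0 < Num.ceil x by rewrite ceil_gt0; apply: lt_le_trans nux.
have [n cn] : exists n : nat, Num.ceil x = n%:Z.
  by exists `|Num.ceil x|%N; rewrite gez0_abs// ltW.
rewrite cn in c0 cx h; rewrite -pmulrn -natrM ler_nat in h.
have nN : (n <= N %/ m)%N by rewrite leq_divRL//; lia.
split; first by apply: leq_trans nN; lia.
apply: le_trans nux (le_trans cx _).
by rewrite -pmulrn ler_nat.
Qed.

(** For V < 288 the exponential is at least exp(-6) >= 1/512, while N >= 24 gives
N^2 + 1 >= 577. *)
Lemma confidence_vacuous (R : realType) (L N V : nat) :
  (0 < L)%N -> (24 <= N)%N -> (V < 288)%N ->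
  1 <= (L%:R ^+ 2 * N%:R ^+ 2 + 1) * expR (- (V%:R / 48)) :> R.
Proof.
move=> L0 N24 V288.
have e6 : expR (V%:R / 48 : R) <= 512.
  apply: (@le_trans _ _ (expR (2 / 3) ^+ 9)).
    rewrite -expRM_natl ler_expR.
    have : V%:R <= 288 :> R by rewrite ler_nat ltnW.
    lra.
  apply: (@le_trans _ _ (2 ^+ 9)); last by rewrite -natrX ler_nat.
  by rewrite lerXn2r ?nnegrE ?expR_ge0 ?expR_two_thirds.
rewrite expRN -ler_pdivrMr ?invr_gt0 ?expR_gt0// invrK mul1r.
apply: le_trans e6 _; rewrite -!natrX -natrM natr1 ler_nat.
nia.
Qed.

(** The ratio exp(-V/36) / exp(-V/48) = exp(-V/144) is at most exp(-2) <= 1/4. *)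
Lemma confidence_budget (R : realType) (L N V c : nat) :
  (c <= L * (2 * N))%N -> (288 <= V)%N ->
  (c * c)%:R * expR (- (V%:R / 36)) <=
    L%:R ^+ 2 * N%:R ^+ 2 * expR (- (V%:R / 48)) :> R.
Proof.
move=> cL V288.
have cc : (c * c)%:R <= 4 * (L%:R ^+ 2 * N%:R ^+ 2) :> R.
  rewrite -!natrX -!natrM ler_nat; apply: leq_trans (leq_mul cL cL) _.
  by apply/eq_leq; rewrite !expnS !expn0; ring.
apply: le_trans (ler_wpM2r (expR_ge0 _) cc) _.
rewrite mulrAC mulrC -subr_ge0 -mulrBr mulr_ge0//.
rewrite subr_ge0.
have -> : - (V%:R / 36) = - (V%:R / 48) - V%:R / 144 :> R by lra.
rewrite expRD mulrCA ler_piMr ?expR_ge0//.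
rewrite expRN ler_pdivrMr ?expR_gt0// mul1r.
apply: (@le_trans _ _ (expR 1 ^+ 2)).
  have e1 : 2 <= expR 1 :> R by have := expR_ge1Dx (1 : R); lra.
  by apply: (@le_trans _ _ (2 ^+ 2)); [lra|rewrite lerXn2r ?nnegrE ?expR_ge0].
rewrite -expRM_natl ler_expR.
have : 288 <= V%:R :> R by rewrite ler_nat.
lra.
Qed.

Unset Implicit Arguments.
Set Strict Implicit.
Set Printing Implicit Defensive.

Theorem corollary4p1 (R : realType) (d d' : measure_display)
  (X : measurableType d) (P : probability (X * R)%type R)
  (P_Y2 : ('E_P[(fun z : X * R => (z.2 ^+ 2)%R)] < +oo)%E)
  (* the model F, a linear subspace of L^2(P_X), and its oracle *)
  (F : {pred X -> R})
  (F_L2 : {subset F <= Lfun (marginalX P) 2%:E})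
  (F_lin : submod_closed F)
  (fstar : X -> R) (fstar_oracle : is_oracle P F fstar)
  (* the data: outliers are indexed by O, informative data by ~: O *)
  (Omega : measurableType d') (Pr : probability Omega R)
  (N : nat) (N_ge8 : (8 <= N)%N)
  (Z : 'I_N -> {RV Pr >-> (X * R)%type}) (O : {set 'I_N})
  (Z_iid : iid_on Z (~: O)%SET P)
  (Z_indep : independent_subfamilies Z O (~: O)%SET)
  (* the learning algorithms *)
  (Lambda : finType)
  (G : Lambda -> forall n, n.-tuple (X * R)%type -> X -> R)
  (G_alg : forall l, learning_algorithm F (G l))
  (* the training blocks *)
  (Kmin Kmax : nat) (Kmin_ge3 : (3 <= Kmin)%N) (Kmin_max : (Kmin <= Kmax)%N)
  (Kmax_log : (Kmax <= trunc_log 2 N)%N)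
  (Bl : forall K : nat, 'I_(2 ^ K) -> {set 'I_N})
  (Bl_part : forall K, (Kmin <= K <= Kmax)%N ->
     is_partition_of (Bl K) [set: 'I_N]%SET)
  (Bl_large : forall K, (Kmin <= K <= Kmax)%N -> forall k,
     (N %/ 2 ^ K <= #|Bl K k|)%N)
  (Bl_small : forall K, (Kmin <= K <= Kmax)%N -> forall k,
     #|Bl K k|%:R < N%:R / 4 :> R)
  (* the test folds *)
  (V : nat) (V_ge3 : (3 <= V)%N) (V_le : V%:R <= N%:R / 8 :> R)
  (T : Lambda * {set 'I_N} -> Lambda * {set 'I_N} -> 'I_V -> {set 'I_N})
  (T_part : forall m m',
     m \in candidates Lambda (all_blocks Kmin Kmax Bl) ->
     m' \in candidates Lambda (all_blocks Kmin Kmax Bl) ->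
     exists2 D : {set 'I_N}, D \subset (~: (m.2 :|: m'.2))%SET &
       is_partition_of (T m m') D)
  (T_large : forall m m',
     m \in candidates Lambda (all_blocks Kmin Kmax Bl) ->
     m' \in candidates Lambda (all_blocks Kmin Kmax Bl) ->
     forall v, N%:R / (4 * V%:R) <= #|T m m' v|%:R :> R)
  (* medians of the tests, and the selected candidate *)
  (TT : Omega -> Lambda * {set 'I_N} -> Lambda * {set 'I_N} -> R)
  (TT_med : forall w m m',
     m \in candidates Lambda (all_blocks Kmin Kmax Bl) ->
     m' \in candidates Lambda (all_blocks Kmin Kmax Bl) ->
     is_median
       (fun v => empirical (fun i => Z i w) (T m m' v)
          (fun z => gamma (estimator G (fun i => Z i w) m) z
                    - gamma (estimator G (fun i => Z i w) m') z))
       (TT w m m'))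
  (mhat : Omega -> Lambda * {set 'I_N})
  (mhat_argmin : forall w,
     is_minimax (candidates Lambda (all_blocks Kmin Kmax Bl)) (TT w) (mhat w))
  (* moment assumptions *)
  (chi sigma : R) (chi_gt0 : 0 < chi) (sigma_gt0 : 0 < sigma)
  (F_chi : forall f, f \in F ->
     (poweR 'E_P[(fun z : X * R => (f z.1 ^+ 4)%R)] (4^-1)
      <= chi%:E * poweR 'E_P[(fun z : X * R => (f z.1 ^+ 2)%R)] (2^-1))%E)
  (F_sigma : forall f, f \in F ->
     ('E_P[(fun z : X * R => ((z.2 - fstar z.1) ^+ 2 * (f z.1 - fstar z.1) ^+ 2)%R)]
      <= (sigma ^+ 2)%:E * 'E_P[(fun z : X * R => ((f z.1 - fstar z.1) ^+ 2)%R)])%E)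
  (* rates of the learning algorithms *)
  (rho : Lambda -> nat -> \bar R)
  (rho_ge0 : forall l n, (0 < n)%N -> (0 <= rho l n)%E)
  (rho_noninc : forall l n n', (0 < n)%N -> (n <= n')%N ->
     (rho l n' <= rho l n)%E)
  (nu : Lambda -> R) (nu_gt0 : forall l, 0 < nu l)
  (N_large : (Num.ceil (\big[Num.max/0]_l nu l))%:~R
             * (maxn (8 * V) (2 ^ Kmin.+1))%:R <= N%:R :> R)
  (O_V : (3 * #|O| <= V)%N) (V_Kmax : (V <= 2 ^ Kmax.-1)%N)
  (G_rate : forall l (B : {set 'I_N}), B \subset (~: O)%SET ->
     nu l <= #|B|%:R ->
     probability_at_least Pr (1 - expR (- (1 / 48)))
       [set w | (excess_risk P fstar (estimator G (fun i => Z i w) (l, B))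
                 <= rho l #|B|)%E])
  (eps : R) (eps_gt0 : 0 < eps) :
  probability_at_least Pr
    (1 - (#|Lambda|%:R ^+ 2 * N%:R ^+ 2 + 1) * expR (- (V%:R / 48)))
    [set w |
      ((1 - a_const chi eps N V)%:E
       * excess_risk P fstar (estimator G (fun i => Z i w) (mhat w))
       <= (1 + 3 * a_const chi eps N V)%:E
          * (\big[mine/+oo]_l rho l (N %/ maxn (4 * V) (2 ^ Kmin))%N)
          + (2 * b_const sigma eps N V)%:E)%E].
Proof.
have N_gt0 : (0 < N)%N by exact: leq_trans N_ge8.
have V_gt0 : (0 < V)%N by exact: leq_trans V_ge3.
set cands := candidates Lambda (all_blocks Kmin Kmax Bl) in T_part T_large TT_med mhat_argmin.
have Lambda_gt0 : (0 < #|Lambda|)%N by apply/card_gt0P; exists (mhat point).1.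
(* For small V the confidence level is nonpositive: the empty event will do. *)
have [V288|V288] := ltnP V 288.
  exists set0; split; [exact: measurable0|exact: sub0set|].
  rewrite measure0 lee_fin subr_le0; apply: confidence_vacuous => //.
  have : (8 * V <= N)%N.
    rewrite -(ler_nat R) natrM mulrC -ler_pdivlMr//.
  lia.
have cand_gt0 m : m \in cands -> (0 < #|m.2|)%N.
  rewrite inE => /andP[_ /all_blocksP[K [KK [k ->]]]].
  apply: leq_trans (Bl_large _ KK k); rewrite divn_gt0 ?expn_gt0//.
  have /andP[/(leq_trans _) + _] := trunc_log_bounds (isT : 1 < 2)%N N_gt0; apply.
  by rewrite leq_exp2l//; case/andP: KK => _ /leq_trans; apply.
have [K [KK V2K KM]] := resolution_level (ltnW (ltnW Kmin_ge3)) Kmin_max V_Kmax V_gt0.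
set mx := maxn (4 * V) (2 ^ Kmin) in KM *.
have mx_gt0 : (0 < mx)%N by rewrite leq_max expn_gt0 orbT.
have {}N_large : (Num.ceil (\big[Num.max/0]_l nu l))%:~R * (2 * mx)%:R <= N%:R :> R.
  apply: le_trans N_large; rewrite (_ : maxn _ _ = (2 * mx)%N)//.
  by rewrite /mx maxnMr expnS; congr maxn; lia.
set size := (N %/ mx)%N.
(* The algorithm that attains the minimal rate is fixed, and it is enough that
   one clean block trains this algorithm well. *)
have [lstar _ rho_min] : exists2 l, true &
    \big[mine/+oo%E]_l rho l size = rho l size.
  have [l _ ->] := eq_bigmin (mhat point).1 xpredT (fun l => rho l size) isT
    (fun i _ => leey _).
  by exists l.
have [size_gt0 nu_size] := training_size_large (nu_gt0 lstar) mx_gt0 N_large.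
have size_block k : (size <= #|Bl K k|)%N.
  by apply: leq_trans (Bl_large _ KK k); rewrite leq_div2l// expn_gt0.
have Bl_disj := (Bl_part _ KK).1.
pose clean := [set k | Bl K k \subset (~: O)%SET]%SET.
(* At most V / 3 of the 2 ^ K >= 2 V blocks meet the outliers. *)
have clean_ge : (V <= #|clean|)%N.
  have : (#|~: clean| <= #|O|)%N := card_meeting_le O Bl_disj.
  have := cardsC clean; rewrite card_ord; lia.
have clean_rate k : k \in clean -> probability_at_least Pr (1 - expR (- (1 / 48)))
   [set w | (excess_risk P fstar (estimator G (fun i => Z i w) (lstar, Bl K k))
        <= rho lstar #|Bl K k|)%E].
  rewrite inE => kO; apply: G_rate => //.
  by apply: le_trans nu_size _; rewrite ler_nat.
have clean_ok k : k \in clean -> Bl K k \subset (~: O)%SET /\ (0 < #|Bl K k|)%N.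
  by rewrite inE => kO; split => //; apply: leq_trans (size_block k).
have [m_fail P_fail] := some_block_well_trained P_Y2 F_L2 F_lin fstar_oracle Z_iid
  Z_indep G_alg Bl_disj clean_ok clean_rate.
set fail := (\bigcap_(k in [set` clean]) _) in m_fail P_fail.
pose bad (p : (Lambda * {set 'I_N}) * (Lambda * {set 'I_N})) : set Omega :=
  [set w | (V <= 6 * #|misled_folds P fstar chi sigma eps Z O (p.1.2 :|: p.2.2)%SET
    (fitted Z G p.1) (fitted Z G p.2) (T p.1 p.2) w|)%N].
have T_disj m m' : m \in cands -> m' \in cands ->
    forall u v, u != v -> [disjoint T m m' u & T m m' v]%bool.
  by move=> mC m'C; have [D _ []] := T_part _ _ mC m'C.
have T_test m m' : m \in cands -> m' \in cands ->
    forall v, [disjoint (m.2 :|: m'.2)%SET & T m m' v]%bool.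
  move=> mC m'C v; have [D DC [_ DE]] := T_part _ _ mC m'C.
  rewrite disjoint_sym finset.disjoints_subset; apply: fintype.subset_trans DC.
  by rewrite -DE; exact: (finset.bigcup_sup v).
have bad_rare p : p \in finset.setX cands cands ->
    measurable (bad p) /\ (Pr (bad p) <= (expR (- (V%:R / 36)))%:E)%E.
  case: p => m m'; rewrite inE => /andP[/= mC m'C].
  have hF w : fitted Z G m w \in F by apply: fitted_in_F => //; exact: cand_gt0.
  have h'F w : fitted Z G m' w \in F by apply: fitted_in_F => //; exact: cand_gt0.
  have mh : jointly_measurable (fitted Z G m : info Z (m.2 :|: m'.2)%SET -> X -> R).
    exact: (measurable_fitted (Z := Z) G_alg (cand_gt0 _ mC) (finset.subsetUl _ _)).
  have mh' : jointly_measurable (fitted Z G m' : info Z (m.2 :|: m'.2)%SET -> X -> R).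
    exact: (measurable_fitted (Z := Z) G_alg (cand_gt0 _ m'C) (finset.subsetUr _ _)).
  exact: (many_misled_folds P_Y2 F_L2 F_lin fstar_oracle chi_gt0 sigma_gt0 eps_gt0
    F_chi F_sigma N_gt0 Z_iid Z_indep V_gt0 hF h'F mh mh'
    (T_disj _ _ mC m'C) (T_test _ _ mC m'C) (T_large _ _ mC m'C)).
have [m_bad P_bad] := union_bound bad_rare.
set Bad := (\bigcup_(p in _) _) in m_bad P_bad.
have m_BF : measurable (Bad `|` fail) by exact: measurableU.
exists (~` (Bad `|` fail)); split; first exact: measurableC.
  move=> w /= /not_orP[w_bad w_fail].
  pose loss m := regret P fstar (fitted Z G m w).
  have close m m' : m \in cands -> m' \in cands ->
      `|TT w m m' - (loss m - loss m')|
        <= a_const chi eps N V * (loss m + loss m') + b_const sigma eps N V.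
    move=> mC m'C.
    apply: (few_misled_folds (J := (m.2 :|: m'.2)%SET)
      (T_disj _ _ mC m'C) O_V _ (TT_med w _ _ mC m'C)) => mis.
    by apply: w_bad; exists (m, m') => //=; rewrite inE/= mC.
  have [k kC trained] : exists2 k, k \in clean &
      ((loss (lstar, Bl K k))%:E <= rho lstar #|Bl K k|)%E.
    apply: contrapT => nk; apply: w_fail => k /= kC.
    by rewrite /poorly_trained/= ltNge; apply/negP => le; apply: nk; exists k.
  have m0C : (lstar, Bl K k) \in cands.
    by rewrite inE/= inE/=; apply/all_blocksP; exists K; split => //; exists k.
  have a_ge0 : 0 <= a_const chi eps N V.
    by rewrite addr_ge0 ?mulr_ge0 ?sqrtr_ge0 ?sqr_ge0// ltW.
  have b_ge0 : 0 <= b_const sigma eps N V.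
    by rewrite divr_ge0 ?mulr_ge0 ?sqr_ge0// ltW.
  have sel := minimax_selection a_ge0 b_ge0 (fun m => regret_ge0 P fstar _)
    close (mhat_argmin w) m0C.
  have mhat_F : estimator G (fun i => Z i w) (mhat w) \in F.
    apply: (fitted_in_F Z G_alg w); apply: cand_gt0; exact: (mhat_argmin w).1.
  rewrite (excess_riskE P_Y2 F_L2 F_lin fstar_oracle mhat_F) -EFinM rho_min.
  have a3 : 0 <= 1 + 3 * a_const chi eps N V by rewrite addr_ge0// mulr_ge0.
  apply: le_trans (_ : ((1 + 3 * a_const chi eps N V) * loss (lstar, Bl K k)
    + 2 * b_const sigma eps N V)%:E <= _)%E; first by rewrite lee_fin.
  rewrite EFinD leeD2r// EFinM lee_wpmul2l// ?lee_fin//.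
  exact: le_trans trained (rho_noninc _ _ _ size_gt0 (size_block k)).
rewrite probability_setC//.
have P_BF : (Pr (Bad `|` fail) <=
    ((#|Lambda|%:R ^+ 2 * N%:R ^+ 2 + 1) * expR (- (V%:R / 48)))%:E)%E.
  apply: le_trans (measureU2 _ m_bad m_fail) _.
  apply: le_trans (leeD P_bad P_fail) _.
  rewrite -EFinD lee_fin mulrDl mul1r lerD//.
    rewrite cardsX; apply: confidence_budget => //.
    rewrite /cands cardsX cardsT leq_mul2l; apply/orP; right.
    exact: card_all_blocks.
  by rewrite ler_expR lerN2 ler_pM2r ?ler_nat// invr_gt0.
have PrBF_fin : Pr (Bad `|` fail) \is a fin_num by exact: fin_num_measure.
rewrite -(fineK PrBF_fin) in P_BF *.
by rewrite -EFinB lee_fin lerD2l lerN2 -lee_fin.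
Qed.
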